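(* Let $\mathscr{A}$ be a commutative unital $C^*$-algebra generated by $t\in\mathscr{A}$ (i.e. $\mathscr{A}=C^*(t)$), and let $\Xi\subseteq\mathbb{Z}_+^2$. Set $\Sigma=\{(p,q,r)\in\mathbb{Z}_+^3\colon p\neq q \text{ and } p+q<2r\}$. Suppose that one of the following conditions holds: (i) $(p,q),(r,r)\in\Xi$ for some $(p,q,r)\in\Sigma$, and $\gcd\{m-n\colon (m,n)\in\Xi\}=1$; (ii) $\Xi=\{(p,q),(r,r)\}$ for some $(p,q,r)\in\Sigma$, and there exist $\epsilon>0$ and pairwise disjoint Borel sets $L_0,\ldots,L_{n-1}\subseteq\{e^{i\phi}\colon \phi\in[0,\frac{2\pi}{n})\}$, where $n=|p-q|$, such that $$\sigma(t)\subseteq\bigcup_{j=0}^{n-1}\Big\{\eta\,\omega\, e^{i\frac{2\pi j}{n}}\colon \eta\in[\epsilon,\infty),\ \omega\in L_j\Big\}.$$ Then $G:=\{t^{*m}t^n\colon (m,n)\in\Xi\}$ generates $\mathscr{A}$ (i.e. $\mathscr{A}=C^*(G)$) and is hyperrigid in $\mathscr{A}$.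
   Context: $\mathbb{Z}_+$ is the set of nonnegative integers; $\sigma(t)$ is the spectrum of $t$. The greatest common divisor of a (possibly infinite) set of integers, not all $0$, is taken to be positive; writing $\gcd(J)$ presupposes that $J$ contains a nonzero integer. Hilbert spaces are complex; $\boldsymbol{B}(\mathcal{H})$ is the $C^*$-algebra of bounded linear operators on $\mathcal{H}$. For a unital $C^*$-algebra $\mathscr{A}$ with unit $e$ and nonempty $G\subseteq\mathscr{A}$ (not necessarily containing $e$), $C^*(G)$ is the smallest $C^*$-subalgebra of $\mathscr{A}$ containing $G\cup\{e\}$; $C^*(t)=C^*(\{t\})$. By convention $t^0=t^{*0}=e$. Completely positive maps are linear; UCP means unital completely positive; representations of unital $C^*$-algebras are unital $*$-homomorphisms into $\boldsymbol{B}(\mathcal{H})$. Hyperrigidity: a nonempty subset $G$ of a unital $C^*$-algebra $\mathscr{A}$ is hyperrigid (in $\mathscr{A}$) if for any faithful representation $\pi\colon\mathscr{A}\to\boldsymbol{B}(\mathcal{H})$ on a Hilbert space $\mathcal{H}$ and any sequence $\Phi_k\colon\boldsymbol{B}(\mathcal{H})\to\boldsymbol{B}(\mathcal{H})$ ($k\in\mathbb{N}$) of UCP maps, if $\lim_{k\to\infty}\|\Phi_k(\pi(g))-\pi(g)\|=0$ for all $g\in G$, then $\lim_{k\to\infty}\|\Phi_k(\pi(a))-\pi(a)\|=0$ for all $a\in\mathscr{A}$. *)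

(* Defs.v *)
From HB Require Import structures.
From mathcomp Require Import all_boot all_order all_algebra.
From mathcomp Require Import complex.
From mathcomp Require Import all_classical all_reals all_analysis.

Set Implicit Arguments.
Unset Strict Implicit.
Unset Printing Implicit Defensive.

Import Order.TTheory GRing.Theory Num.Theory.
Import numFieldNormedType.Exports.

Local Open Scope classical_set_scope.
Local Open Scope complex_scope.
Local Open Scope ring_scope.

(* Unital C*-algebras, possibly zero.  The scalars are R[i] with R a model of
   the reals, and norms are R[i]-valued (hence real and nonnegative).  The
   product and the unit are fields of the mixin because Hierarchy Builder cannot
   join a normed module with a (semi)ring: that join is already taken by
   numDomainType.  The ring structure is recovered right after. *)
HB.mixin Record CompleteNormedModule_isCstarAlgebra (R : realType) A
    & CompleteNormedModule R[i] A := {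
  cstar_mul : A -> A -> A ;
  cstar_one : A ;
  star : A -> A ;
  cstar_mulA : associative cstar_mul ;
  cstar_mul1l : left_id cstar_one cstar_mul ;
  cstar_mul1r : right_id cstar_one cstar_mul ;
  cstar_mulDl : left_distributive cstar_mul +%R ;
  cstar_mulDr : right_distributive cstar_mul +%R ;
  cstar_scaleAl : forall (a : R[i]) (x y : A),
    a *: cstar_mul x y = cstar_mul (a *: x) y ;
  cstar_scaleAr : forall (a : R[i]) (x y : A),
    a *: cstar_mul x y = cstar_mul x (a *: y) ;
  starK : involutive star ;
  starD : {morph star : x y / x + y} ;
  starZ : forall (a : R[i]) (x : A), star (a *: x) = a^*%R *: star x ;
  starM : forall x y : A, star (cstar_mul x y) = cstar_mul (star y) (star x) ;
  cstar_normM : forall x y : A, `|cstar_mul x y| <= `|x| * `|y| ;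
  cstar_norm : forall x : A, `|cstar_mul (star x) x| = `|x| ^+ 2
}.

#[short(type="cstarAlgType")]
HB.structure Definition CstarAlgebra (R : realType) :=
  {A of CompleteNormedModule R[i] A & CompleteNormedModule_isCstarAlgebra R A}.

HB.instance Definition _ (R : realType) (A : cstarAlgType R) :=
  GRing.Zmodule_isPzRing.Build (CstarAlgebra.sort A)
    (@cstar_mulA R A) (@cstar_mul1l R A) (@cstar_mul1r R A)
    (@cstar_mulDl R A) (@cstar_mulDr R A).

(* Complex Hilbert spaces; the inner product is linear on the left. *)
HB.mixin Record CompleteNormedModule_isHilbert (R : realType) H
    & CompleteNormedModule R[i] H := {
  inner : H -> H -> R[i] ;
  inner_linear : forall y : H, linear_for *%R (fun x : H => inner x y) ;
  inner_conj : forall x y : H, inner y x = (inner x y)^*%R ;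
  inner_norm : forall x : H, inner x x = `|x| ^+ 2
}.

#[short(type="hilbertType")]
HB.structure Definition Hilbert (R : realType) :=
  {H of CompleteNormedModule R[i] H & CompleteNormedModule_isHilbert R H}.

Section BoundedOperators.
Context {R : realType} {H : hilbertType R}.

Definition bounded_op : {pred H -> H} := [pred f : H -> H |
  `[< linear f /\ exists M : R[i], forall x, `|f x| <= M * `|x| >]].

Lemma bounded_opP (f : H -> H) :
  reflect (linear f /\ exists M : R[i], forall x, `|f x| <= M * `|x|)
          (f \in bounded_op).
Proof. exact: asboolP. Qed.

Lemma bounded_op_ge0 (f : H -> H) : f \in bounded_op ->
  exists2 M : R[i], 0 <= M & forall x, `|f x| <= M * `|x|.
Proof.
move=> /bounded_opP[_ [M fM]]; exists `|M| => // x.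
apply: le_trans (real_ler_norm _) _.
  by rewrite realE normr_ge0.
rewrite normr_id -[`|x|]normr_id -normrM.
by rewrite (le_trans (fM x))// real_ler_norm// ger0_real// (le_trans _ (fM x)).
Qed.

Lemma bounded_op_submod_closed : submod_closed bounded_op.
Proof.
split.
  apply/bounded_opP; split.
    by move=> a x y; rewrite /= scaler0 addr0.
  by exists 0 => x; rewrite mul0r normr0.
move=> a f g bf bg.
have [lf _] := bounded_opP _ bf; have [lg _] := bounded_opP _ bg.
have [M M0 fM] := bounded_op_ge0 bf; have [N N0 gN] := bounded_op_ge0 bg.
apply/bounded_opP; split.
  move=> b x y; rewrite /= !fctE /= lf lg !scalerDr !scalerA.
  by rewrite [b * a]mulrC addrACA.
exists (`|a| * M + N) => x; rewrite /= !fctE.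
rewrite (le_trans (ler_normD _ _))// mulrDl lerD// normrZ -mulrA.
by rewrite ler_wpM2l.
Qed.

HB.instance Definition _ :=
  GRing.isSubmodClosed.Build R[i] (H -> H) bounded_op bounded_op_submod_closed.

End BoundedOperators.

Section BoundedOperatorsRing.
Context {R : realType}.

Record bop (H : hilbertType R) :=
  Bop { bop_fun :> H -> H ; bop_bounded : bop_fun \in bounded_op }.

Variable H : hilbertType R.

HB.instance Definition _ := [isSub for @bop_fun H].
HB.instance Definition _ := [Choice of bop H by <:].
HB.instance Definition _ := [SubChoice_isSubLmodule of bop H by <:].

Implicit Types S T U : bop H.

Lemma bop_linear T : linear T.
Proof. by have /bounded_opP[] := bop_bounded T. Qed.

Lemma bop_ext S T : S =1 T -> S = T.
Proof. by move=> ST; apply/val_inj/funext. Qed.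

Fact bop_id_subproof : (id : H -> H) \in bounded_op.
Proof. by apply/bounded_opP; split=> //; exists 1 => x; rewrite mul1r. Qed.

Fact bop_comp_subproof S T : (S \o T : H -> H) \in bounded_op.
Proof.
apply/bounded_opP; split.
  by move=> a x y; rewrite /= !bop_linear.
have [M M0 SM] := bounded_op_ge0 (bop_bounded S).
have [N N0 TN] := bounded_op_ge0 (bop_bounded T).
by exists (M * N) => x /=; rewrite (le_trans (SM _))// -mulrA ler_wpM2l.
Qed.

Definition bop_id : bop H := Bop bop_id_subproof.
Definition bop_comp S T : bop H := Bop (bop_comp_subproof S T).

Fact bop_compA : associative bop_comp. Proof. by move=> S T U; exact: bop_ext. Qed.
Fact bop_comp1l : left_id bop_id bop_comp. Proof. by move=> S; exact: bop_ext. Qed.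
Fact bop_comp1r : right_id bop_id bop_comp. Proof. by move=> S; exact: bop_ext. Qed.
Fact bop_compDl : left_distributive bop_comp +%R.
Proof. by move=> S T U; exact: bop_ext. Qed.
Fact bop_compDr : right_distributive bop_comp +%R.
Proof.
move=> S T U; apply: bop_ext => x /=.
by have := bop_linear S 1 (T x) (U x); rewrite !scale1r.
Qed.

HB.instance Definition _ := GRing.Zmodule_isPzRing.Build (bop H)
  bop_compA bop_comp1l bop_comp1r bop_compDl bop_compDr.

Definition opnorm T : R := sup [set complex.Re `|T x| | x in [set x : H | `|x| <= 1]].

(* [adjoint S T] : S is the Hilbert space adjoint of T. *)
Definition adjoint S T := forall x y : H, inner (T x) y = inner x (S y).

(* Positivity in M_n(B(H)), identified as usual with B(H^n). *)
Definition mx_positive n (T : 'M[bop H]_n) :=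
  forall x : 'I_n -> H, 0 <= \sum_i \sum_j inner (T i j (x j)) (x i).

Definition completely_positive (Phi : bop H -> bop H) :=
  linear Phi /\
  forall n (T : 'M[bop H]_n), mx_positive T -> mx_positive (map_mx Phi T).

Definition ucp (Phi : bop H -> bop H) := completely_positive Phi /\ Phi 1 = 1.

End BoundedOperatorsRing.

Section CstarAlgebraNotions.
Context {R : realType} {A : cstarAlgType R}.

Definition representation (H : hilbertType R) (f : A -> bop H) :=
  [/\ linear f, {morph f : x y / x * y}, f 1 = 1
    & forall x, adjoint (f (star x)) (f x)].

Definition faithful_representation (H : hilbertType R) (f : A -> bop H) :=
  representation f /\ injective f.

Definition hyperrigid (G : set A) :=
  G !=set0 /\
  forall (H : hilbertType R) (f : A -> bop H), faithful_representation f ->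
  forall Phi : nat -> bop H -> bop H, (forall k, ucp (Phi k)) ->
    (forall g, G g -> opnorm (Phi k (f g) - f g) @[k --> \oo] --> (0 : R)) ->
    forall a, opnorm (Phi k (f a) - f a) @[k --> \oo] --> (0 : R).

(* C*-subalgebras, not required to contain the unit. *)
Definition cstar_subalgebra (S : set A) :=
  [/\ S 0,
      forall (a : R[i]) x y, S x -> S y -> S (a *: x + y),
      forall x y, S x -> S y -> S (x * y),
      forall x, S x -> S (star x)
    & closed S].

Definition cstar_gen (G : set A) : set A :=
  smallest cstar_subalgebra (G `|` [set 1]).

Definition spectrum (t : A) : set R[i] :=
  [set z : R[i] | ~ exists s : A, s * (t - z *: (1 : A)) = 1 /\ (t - z *: (1 : A)) * s = 1].

End CstarAlgebraNotions.

Definition is_gcd (J : set int) (d : int) :=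
  [/\ exists2 m, J m & m != 0,
      0 < d,
      forall m, J m -> (d %| m)%Z
    & forall c : int, (forall m, J m -> (c %| m)%Z) -> c <= d].

Definition Sigma : set (nat * nat * nat) :=
  [set u | u.1.1 <> u.1.2 /\ (u.1.1 + u.1.2 < 2 * u.2)%N].

Section ComplexPlane.
Context {R : realType}.

Definition expi (phi : R) : R[i] := cos phi +i* sin phi.

(* R[i]^o carries the topology of the complex modulus. *)
Definition borel : set (set R[i]) := <<s @open R[i]^o >>.

End ComplexPlane.

(* Main.v *)
(* Generation.  By Stone-Weierstrass it is enough that a character chi is
   determined at t by its values at the t^*^m t^n.  These values give |chi t|
   and the powers of the phase of chi t with exponents n - m, hence the phase
   itself when their gcd is 1, or when z |-> z^n is injective on the phases of
   the spectrum.

   Hyperrigidity.  Put b = t^* t, x = t^*^p t^q and F_j = Phi_k (b^j), and read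
   all relations asymptotically in k.  From F_0 = 1, F_r = b^r and the
   log-convexity of (F_j), a maximum principle gives F_j <= b^j for j <= r.
   Let 2 <= p + q < 2 r and i = (p + q) %/ 2 < r, l = p + q - i <= r (if
   p + q = 1, the Schwarz inequality for x suffices).  Positivity of the Gram
   matrix of k1, k2 with k1^* k1 = b^i, k2^* k2 = b^l and k1^* k2 = x turns
   Phi_k x = x into the reverse inequality F_i >= b^i.  Since F_i = b^i while
   F_(i-1) and F_(i+1) are bounded above, equality holds in the Cauchy-Schwarz
   inequality between them, which yields F_m = b^m for all m >= i.  So b^r,
   hence b, hence every t^*^m t^n asymptotically fixed by Phi_k, lies in the
   asymptotic multiplicative domain, a C*-subalgebra. *)

Require Import Defs.
From HB Require Import structures.
From mathcomp Require Import all_boot all_order all_algebra.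
From mathcomp Require Import complex ring lra zify.
From mathcomp Require Import all_classical all_reals all_analysis.

Set Implicit Arguments.
Unset Strict Implicit.
Unset Printing Implicit Defensive.

Import Order.TTheory GRing.Theory Num.Theory.
Import numFieldNormedType.Exports.

Local Open Scope classical_set_scope.
Local Open Scope complex_scope.
Local Open Scope ring_scope.

(** * Real-valued norms *)

(** The operators [Psi n (b ^+ j)] need not commute with each other or with [f b], so log-convexity
    is only an inequality between quadratic forms in two free vectors, and no pointwise maximum
    principle applies. The substitute is of Lyapunov type: if B is bounded below by a positive
    scalar and the symmetric part of X B is nonnegative, then X is nonnegative. As b may fail to be
    invertible, it is compared with b + d for small d > 0. No limit object is formed: every
    asymptotic relation carries an error that is uniform in the vectors. On the commutative side
    neither maximal ideals nor quotients nor a topology on the characters occur. Zorn's lemma is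
    applied to power-multiplicative seminorms: a minimal one that remembers a given value is
    multiplicative, hence the modulus of a character; a minimal one that keeps an element away from
    a subalgebra yields Stone-Weierstrass. Positivity of an element means positivity at all
    characters, and square roots transport it to quadratic forms. *)

Section RealNorm.
Context {R : realType}.

(** The order of R[i] is partial; infima, suprema and linear arithmetic need the norm as an element
    of R. *)
Definition nrm {V : normedZmodType R[i]} (v : V) : R := complex.Re `|v|.

Lemma nrmE (V : normedZmodType R[i]) (v : V) : `|v| = (nrm v)%:C.
Proof. by rewrite /nrm RRe_real// normr_real. Qed.

Section Zmod.
Context {V : normedZmodType R[i]}.
Implicit Types v w : V.

Lemma nrm_ge0 v : 0 <= nrm v.
Proof. by rewrite -ler0c -nrmE. Qed.

Lemma nrm0 : nrm (0 : V) = 0.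
Proof. by rewrite /nrm normr0. Qed.

Lemma nrm_eq0 v : nrm v = 0 -> v = 0.
Proof. by move=> v0; apply/eqP; rewrite -normr_eq0 nrmE v0. Qed.

Lemma nrmN v : nrm (- v) = nrm v.
Proof. by rewrite /nrm normrN. Qed.

Lemma nrm_distC v w : nrm (v - w) = nrm (w - v).
Proof. by rewrite /nrm distrC. Qed.

Lemma ler_nrmD v w : nrm (v + w) <= nrm v + nrm w.
Proof. by rewrite -lecR rmorphD /= -!nrmE ler_normD. Qed.

Lemma ler_nrmB v w : nrm (v - w) <= nrm v + nrm w.
Proof. by rewrite -(nrmN w) ler_nrmD. Qed.
End Zmod.

Lemma nrmZ (V : normedModType R[i]) (a : R[i]) (v : V) :
  nrm (a *: v) = nrm a * nrm v.
Proof. by apply: complexI; rewrite rmorphM /= -!nrmE normrZ. Qed.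

Lemma nrmM (a b : R[i]) : nrm (a * b) = nrm a * nrm b.
Proof. by apply: complexI; rewrite rmorphM /= -!nrmE normrM. Qed.

Lemma nrm1 : nrm (1 : R[i]) = 1.
Proof. by rewrite /nrm normr1. Qed.

Lemma nrmX (a : R[i]) n : nrm (a ^+ n) = nrm a ^+ n.
Proof. by elim: n => [|n IH]; rewrite ?expr0 ?nrm1// !exprS nrmM IH. Qed.

Lemma nrmC (x : R) : nrm x%:C = `|x|.
Proof. by rewrite /nrm normc_def/= expr0n addr0 sqrtr_sqr. Qed.

Lemma nrmJ (a : R[i]) : nrm a^* = nrm a.
Proof. by rewrite /nrm normcJ. Qed.

Lemma nrmV (a : R[i]) : nrm a^-1 = (nrm a)^-1.
Proof. by apply: complexI; rewrite -nrmE normfV nrmE fmorphV. Qed.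

Lemma sqr_nrm (a : R[i]) : (nrm a ^+ 2)%:C = a * a^*.
Proof. by rewrite -sqr_normc nrmE rmorphXn. Qed.

Lemma nrm_ge_Re (a : R[i]) : `|complex.Re a| <= nrm a.
Proof. by rewrite -lecR -nrmE normc_ge_Re. Qed.

Lemma sqr_nrmE (a : R[i]) :
  nrm a ^+ 2 = complex.Re a ^+ 2 + complex.Im a ^+ 2.
Proof. by apply: complexI; rewrite add_Re2_Im2 nrmE rmorphXn. Qed.

Lemma nrm_ge_Im (a : R[i]) : `|complex.Im a| <= nrm a.
Proof.
rewrite -(@ler_pXn2r _ 2) ?nnegrE ?nrm_ge0// real_normK ?num_real//.
by rewrite sqr_nrmE lerDr sqr_ge0.
Qed.

Lemma nrm_le_ReIm (a : R[i]) : nrm a <= `|complex.Re a| + `|complex.Im a|.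
Proof.
rewrite -(@ler_pXn2r _ 2) ?nnegrE ?nrm_ge0 ?addr_ge0// sqr_nrmE sqrrD.
rewrite !real_normK ?num_real// lerD2r lerDl.
by rewrite mulrn_wge0// mulr_ge0.
Qed.
End RealNorm.

(** * Gelfand theory of commutative C*-algebras *)

Section CstarNorm.
Context {R : realType} {A : cstarAlgType R}.

Lemma scalerAlA (c : R[i]) (x y : A) : c *: (x * y) = (c *: x) * y.
Proof. exact: cstar_scaleAl. Qed.

Lemma scalerArA (c : R[i]) (x y : A) : c *: (x * y) = x * (c *: y).
Proof. exact: cstar_scaleAr. Qed.

Lemma nrmMA (x y : A) : nrm (x * y) <= nrm x * nrm y.
Proof. by rewrite -lecR rmorphM /= -!nrmE; exact: cstar_normM. Qed.

Lemma nrm_star_mul (x : A) : nrm (star x * x) = nrm x ^+ 2.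
Proof. by apply: complexI; rewrite rmorphXn /= -!nrmE; exact: cstar_norm. Qed.

Lemma starMA (x y : A) : star (x * y) = star y * star x.
Proof. exact: starM. Qed.

Lemma star0 : star (0 : A) = 0.
Proof. by apply: (addrI (star 0)); rewrite -starD !addr0. Qed.

Lemma starN (x : A) : star (- x) = - star x.
Proof. by apply: (addrI (star x)); rewrite -starD !subrr star0. Qed.

Lemma starB (x y : A) : star (x - y) = star x - star y.
Proof. by rewrite starD starN. Qed.

Lemma star1 : star (1 : A) = 1.
Proof. by rewrite -[LHS]mulr1 -[X in _ * X]starK -starMA mulr1 starK. Qed.

Lemma starX (x : A) n : star (x ^+ n) = star x ^+ n.
Proof.
by elim: n => [|n IH]; rewrite ?expr0 ?star1// exprSr exprS starMA IH.
Qed.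

Lemma nrm_star (x : A) : nrm (star x) = nrm x.
Proof.
suff le y : nrm y <= nrm (star y :> A).
  by apply/eqP; rewrite eq_le le -{2}[x]starK le.
have [->|y0] := eqVneq (nrm y) 0; first exact: nrm_ge0.
have y_gt0 : 0 < nrm y by rewrite lt_def y0 nrm_ge0.
by rewrite -(ler_pM2r y_gt0) -expr2 -nrm_star_mul nrmMA.
Qed.

End CstarNorm.

Section CommutativeCstar.
Context {R : realType} {A : cstarAlgType R}.
Hypothesis A_comm : commutative (fun x y : A => x * y).
#[local] HB.instance Definition _ :=
  GRing.PzRing_hasCommutativeMul.Build (CstarAlgebra.sort A) A_comm.

(** By commutativity [star (x * x) * (x * x)] is also [star y * y] for [y := star x * x], and the
    C*-identity applies to [x * x], to [x] and to [y]. *)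
Lemma nrm_sqr (x : A) : nrm (x * x) = nrm x ^+ 2.
Proof.
apply/eqP; rewrite -(@eqrXn2 _ 2) ?nrm_ge0 ?exprn_ge0 ?nrm_ge0//.
rewrite -(nrm_star_mul (x * x)) -(nrm_star_mul x) -(nrm_star_mul (star x * x)).
rewrite !starMA starK.
by apply/eqP; congr nrm; ring.
Qed.

Lemma nrm1A : (1 : A) <> 0 -> nrm (1 : A) = 1.
Proof.
move=> ne0; have := nrm_sqr 1; rewrite mulr1 expr2 => /esym/eqP.
rewrite -subr_eq0 -{3}[nrm _]mulr1 -mulrBr mulf_eq0 => /orP[/eqP/nrm_eq0//|].
by rewrite subr_eq0 => /eqP.
Qed.

(* Power-multiplicative seminorms below the norm; the sup of |chi| over a
   nonempty set of characters is the typical example. *)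
Record algebra_seminorm (p : A -> R) : Prop := AlgebraSeminorm {
  asn_ge0 : forall x, 0 <= p x ;
  asnD : forall x y, p (x + y) <= p x + p y ;
  asnZ : forall c x, p (c *: x) = nrm c * p x ;
  asnM : forall x y, p (x * y) <= p x * p y ;
  asn_sqr : forall x, p (x * x) = p x ^+ 2 ;
  asn1 : p 1 = 1 ;
  asn_le : forall x, p x <= nrm x }.

Lemma nrm_algebra_seminorm : (1 : A) <> 0 -> algebra_seminorm nrm.
Proof.
move=> ne0; split=> //; [exact: nrm_ge0|exact: ler_nrmD|exact: nrmZ|
  exact: nrmMA|exact: nrm_sqr|exact: nrm1A].
Qed.

Section Localization.
Variables (p : A -> R) (f : A).
Hypotheses (pP : algebra_seminorm p) (f_gt0 : 0 < p f).

(** Localisation at [f]: the quotients decrease with [n], and their limit is the largest seminorm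
    below [p] for which multiplication by [f] scales by [p f]. *)
Definition asn_quot n x : R := p (f ^+ n * x) / p f ^+ n.
Definition asn_loc x : R := inf (range (asn_quot ^~ x)).

Let pfn n : 0 < p f ^+ n. Proof. exact: exprn_gt0. Qed.

Lemma asn_quot_ge0 n x : 0 <= asn_quot n x.
Proof. by rewrite divr_ge0 ?(asn_ge0 pP)// ltW. Qed.

Lemma asn_quotS n x : asn_quot n.+1 x <= asn_quot n x.
Proof.
rewrite /asn_quot ler_pdivrMr// exprS -mulrA exprS.
apply: le_trans (asnM pP _ _) _.
by rewrite mulrCA divfK ?gt_eqF.
Qed.

Lemma asn_quot_mulf n x : asn_quot n (f * x) = p f * asn_quot n.+1 x.
Proof.
rewrite /asn_quot [in RHS]exprSr -mulrA [p f ^+ n.+1]exprS invfM [RHS]mulrCA.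
by rewrite mulVKf ?gt_eqF.
Qed.

Lemma asn_quot_mono m n x : (m <= n)%N -> asn_quot n x <= asn_quot m x.
Proof.
move=> /subnKC <-; elim: (n - m)%N => [|k IH]; first by rewrite addn0.
by rewrite addnS (le_trans (asn_quotS _ _)).
Qed.

Lemma asn_locP x : has_inf (range (asn_quot ^~ x)).
Proof.
split; first by exists (asn_quot 0 x); exists 0%N.
by exists 0 => _ [n _ <-]; exact: asn_quot_ge0.
Qed.

Lemma asn_loc_le n x : asn_loc x <= asn_quot n x.
Proof. by apply: ge_inf; [case: (asn_locP x)|exists n]. Qed.

Lemma asn_loc_approx x e : 0 < e ->
  exists N, forall n, (N <= n)%N -> asn_quot n x < asn_loc x + e.
Proof.
move=> e0; have [_ [N _ <-] lt] := inf_adherent e0 (asn_locP x).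
by exists N => n /asn_quot_mono/le_lt_trans; exact.
Qed.

Lemma le_asn_loc x c : (forall n, c <= asn_quot n x) -> c <= asn_loc x.
Proof.
by move=> le; apply: lb_le_inf; [case: (asn_locP x)|move=> _ [n _ <-]].
Qed.

(** Squaring settles the exponents 2^k; the others follow by submultiplicativity from f^(2^n) = f^n
    f^(2^n - n). *)
Lemma asn_exp n : p (f ^+ n) = p f ^+ n.
Proof.
have upper m : p (f ^+ m) <= p f ^+ m.
  elim: m => [|m IH]; first by rewrite !expr0 (asn1 pP).
  by rewrite !exprS (le_trans (asnM pP _ _))// ler_wpM2l ?(asn_ge0 pP).
have pow2 k : p (f ^+ (2 ^ k)) = p f ^+ (2 ^ k).
  elim: k => [|k IH]; first by rewrite expn0 !expr1.
  by rewrite expnS mul2n -addnn !exprD (asn_sqr pP) IH.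
apply/eqP; rewrite eq_le upper /=.
have le2n : (n <= 2 ^ n)%N by rewrite ltnW// ltn_expl.
rewrite -(ler_pM2r (pfn (2 ^ n - n))) -exprD subnKC// -pow2.
rewrite -{1}(subnKC le2n) exprD (le_trans (asnM pP _ _))//.
by rewrite ler_wpM2l ?(asn_ge0 pP).
Qed.

Lemma asn_loc_seminorm : algebra_seminorm asn_loc.
Proof.
have loc_ge0 x : 0 <= asn_loc x by apply: le_asn_loc => n; exact: asn_quot_ge0.
have locle x : asn_loc x <= p x.
  by have := asn_loc_le 0 x; rewrite /asn_quot !expr0 mul1r divr1.
have loc_mul x y : asn_loc (x * y) <= asn_loc x * asn_loc y.
  (* The index n + n is spent as n on [x] and n on [y]; monotonicity lets one n serve both
     approximations. *)
  have quotM n : asn_quot (n + n) (x * y) <= asn_quot n x * asn_quot n y.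
    rewrite /asn_quot exprD (_ : _ * _ * (x * y) = (f ^+ n * x) * (f ^+ n *
      y)); last by ring.
    by rewrite [X in _ <= X]mulrACA -invfM -exprD ler_pM2r ?invr_gt0//
      (asnM pP).
  have bnd e : 0 < e -> asn_loc (x * y) <= (asn_loc x + e) * (asn_loc y + e).
    move=> e0; have [N hN] := asn_loc_approx x e0; have [M hM] :=
      asn_loc_approx y e0.
    apply: le_trans (asn_loc_le _ _) _; apply: le_trans (quotM (maxn N M)) _.
    by rewrite ler_pM ?asn_quot_ge0// ltW ?hN ?hM ?leq_maxl ?leq_maxr.
  apply/ler_addgt0Pr => e e0; have x0 := loc_ge0 x; have y0 := loc_ge0 y.
  (* For d <= 1 the product of the two perturbed factors exceeds the exact one by at most d s. *)
  set s := asn_loc x + asn_loc y + 1; have s0 : 0 < s by rewrite /s; lra.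
  have d0 : 0 < Num.min 1 (e / s) by rewrite lt_min ltr01 divr_gt0.
  apply: le_trans (bnd _ d0) _; set d := Num.min _ _ in d0 *.
  have d1 : d <= 1 by rewrite ge_min lexx.
  have : d * s <= e by rewrite -ler_pdivlMr// ge_min lexx orbT.
  rewrite /s => ds; have : d * d <= d by rewrite ler_piMl// ltW.
  nra.
split => //.
- move=> x y; apply/ler_addgt0Pr => e e0;
  have e20 : 0 < e / 2 by rewrite divr_gt0.
  have [N hN] := asn_loc_approx x e20; have [M hM] := asn_loc_approx y e20.
  have := hN (maxn N M) (leq_maxl _ _); have := hM (maxn N M) (leq_maxr _ _).
  have := asn_loc_le (maxn N M) (x + y).
  have : asn_quot (maxn N M) (x + y) <= asn_quot (maxn N M) x + asn_quot (maxn
    N M) y.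
    by rewrite /asn_quot -mulrDl ler_pM2r ?invr_gt0// mulrDr (asnD pP).
  lra.
- move=> c x; have quotZ n : asn_quot n (c *: x) = nrm c * asn_quot n x.
    by rewrite /asn_quot -scalerArA (asnZ pP) mulrA.
  apply/eqP; rewrite eq_le; apply/andP; split; last first.
    by apply: le_asn_loc => n; rewrite quotZ ler_wpM2l ?nrm_ge0// asn_loc_le.
  apply/ler_addgt0Pr => e e0; have d0 : 0 < e / (nrm c + 1).
    by rewrite divr_gt0// ltr_wpDl// nrm_ge0.
  have [N /(_ N (leqnn _)) hN] := asn_loc_approx x d0.
  apply: le_trans (asn_loc_le N _) _; rewrite quotZ.
  apply: le_trans (ler_wpM2l (nrm_ge0 _) (ltW hN)) _.
  rewrite mulrDr lerD2l mulrCA ler_piMr ?(ltW e0)//.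
  by rewrite ler_pdivrMr ?mul1r ?lerDl// ltr_wpDl// nrm_ge0.
- move=> x; have quot_sqr n : asn_quot (n + n) (x * x) = asn_quot n x ^+ 2.
    rewrite /asn_quot exprD (_ : _ * _ * (x * x) = (f ^+ n * x) * (f ^+ n *
      x)); last by ring.
    by rewrite (asn_sqr pP) expr_div_n exprD expr2.
  apply/eqP; rewrite eq_le; apply/andP; split.
    by rewrite expr2.
  apply: le_asn_loc => n; apply: le_trans _ (asn_quot_mono (x * x) (leq_addr n
    n)).
  by rewrite quot_sqr lerXn2r ?nnegrE ?asn_quot_ge0 ?asn_loc_le.
- apply/eqP; rewrite eq_le -{1}(asn1 pP) locle; apply: le_asn_loc => n.
  by rewrite /asn_quot mulr1 asn_exp divff ?gt_eqF.
- by move=> x; rewrite (le_trans (locle x))// (asn_le pP).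
Qed.
End Localization.
End CommutativeCstar.

(** * Minimal seminorms *)

Section Minimal.
Context {R : realType} {A : cstarAlgType R}.
Hypothesis A_comm : commutative (fun x y : A => x * y).
#[local] HB.instance Definition _ :=
  GRing.PzRing_hasCommutativeMul.Build (CstarAlgebra.sort A) A_comm.

Definition pointwise_inf (C : set (A -> R)) (x : A) : R :=
  inf [set p x | p in C].

Lemma pointwise_inf_le (C : set (A -> R)) p x :
  (forall q, C q -> algebra_seminorm q) -> C p -> pointwise_inf C x <= p x.
Proof.
move=> CP Cp; apply: ge_inf; last by exists p.
by exists 0 => _ [q /CP qP <-]; exact: asn_ge0.
Qed.

Lemma le_pointwise_inf (C : set (A -> R)) x c :
  C !=set0 -> (forall p, C p -> c <= p x) -> c <= pointwise_inf C x.
Proof.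
move=> [p Cp] le; apply: lb_le_inf; first by exists (p x); exists p.
by move=> _ [q Cq <-]; exact: le.
Qed.

Lemma pointwise_inf_approx (C : set (A -> R)) x e :
  (forall q, C q -> algebra_seminorm q) -> C !=set0 -> 0 < e ->
  exists2 p, C p & p x < pointwise_inf C x + e.
Proof.
move=> CP [p Cp] e0.
have [] := @inf_adherent _ [set p x | p in C] e e0.
  split; first by exists (p x); exists p.
  by exists 0 => _ [q /CP qP <-]; exact: asn_ge0.
by move=> _ [q Cq <-] lt; exists q.
Qed.

(** Totality lets one member of the chain approximate the infimum at two elements at once, as the
    sum and product inequalities require. *)
Lemma chain_pointwise_inf (C : set (A -> R)) :
  C !=set0 -> (forall p, C p -> algebra_seminorm p) ->
  (forall p q, C p -> C q ->
     (forall x, p x <= q x) \/ (forall x, q x <= p x)) ->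
  algebra_seminorm (pointwise_inf C).
Proof.
move=> C0 CP tot; have infle p x : C p -> pointwise_inf C x <= p x.
  exact: pointwise_inf_le.
have inf_ge0 x : 0 <= pointwise_inf C x.
  by apply: le_pointwise_inf => // p /CP/asn_ge0.
have approx2 x y e : 0 < e -> exists2 p, C p &
    p x < pointwise_inf C x + e /\ p y < pointwise_inf C y + e.
  move=> e0; have [p Cp px] := pointwise_inf_approx x CP C0 e0.
  have [q Cq qy] := pointwise_inf_approx y CP C0 e0.
  have [le|le] := tot p q Cp Cq.
    by exists p => //; split=> //; exact: le_lt_trans qy.
  by exists q => //; split=> //; exact: le_lt_trans px.
have infM x y : pointwise_inf C (x * y) <= pointwise_inf C x * pointwise_inf C
  y.
  apply/ler_addgt0Pr => e e0; have x0 := inf_ge0 x; have y0 := inf_ge0 y.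
  set s := pointwise_inf C x + pointwise_inf C y + 1.
  have s0 : 0 < s by rewrite /s; lra.
  have d0 : 0 < Num.min 1 (e / s) by rewrite lt_min ltr01 divr_gt0.
  have [p Cp []] := approx2 x y _ d0; set d := Num.min _ _ in d0 *.
  have d1 : d <= 1 by rewrite ge_min lexx.
  have : d * s <= e by rewrite -ler_pdivlMr// ge_min lexx orbT.
  rewrite /s => ds; have : d * d <= d by rewrite ler_piMl// ltW.
  have := infle _ (x * y) Cp; have := asnM (CP _ Cp) x y.
  have := asn_ge0 (CP _ Cp) x; have := asn_ge0 (CP _ Cp) y.
  nra.
split => //.
- move=> x y; apply/ler_addgt0Pr => e e0.
  have e20 : 0 < e / 2 by rewrite divr_gt0.
  have [p Cp []] := approx2 x y _ e20.
  by have := infle _ (x + y) Cp; have := asnD (CP _ Cp) x y; lra.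
- move=> c x; apply/eqP; rewrite eq_le; apply/andP; split; last first.
    apply: le_pointwise_inf => // p Cp.
    by rewrite (asnZ (CP _ Cp)) ler_wpM2l ?nrm_ge0 ?infle.
  apply/ler_addgt0Pr => e e0; have d0 : 0 < e / (nrm c + 1).
    by rewrite divr_gt0// ltr_wpDl// nrm_ge0.
  have [p Cp hp] := pointwise_inf_approx x CP C0 d0.
  apply: le_trans (infle _ _ Cp) _; rewrite (asnZ (CP _ Cp)).
  apply: le_trans (ler_wpM2l (nrm_ge0 _) (ltW hp)) _.
  rewrite mulrDr lerD2l mulrCA ler_piMr ?(ltW e0)//.
  by rewrite ler_pdivrMr ?mul1r ?lerDl// ltr_wpDl// nrm_ge0.
- move=> x; apply/eqP; rewrite eq_le {1}expr2 infM /=.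
  apply: le_pointwise_inf => // p Cp.
  by rewrite (asn_sqr (CP _ Cp)) lerXn2r ?nnegrE ?infle// (asn_ge0 (CP _ Cp)).
- case: C0 => p Cp; apply/eqP; rewrite eq_le -{1}(asn1 (CP _ Cp)) infle//=.
  by apply: le_pointwise_inf => [|q Cq]; [exists p|rewrite (asn1 (CP _ Cq))].
- by case: C0 => p Cp x; rewrite (le_trans (infle _ _ Cp))// (asn_le (CP _ Cp)).
Qed.

(** Zorn's lemma for the reversed pointwise order. *)
Lemma minimal_seminorm (Q : set (A -> R)) (p0 : A -> R) :
  algebra_seminorm p0 -> Q p0 ->
  (forall C, C !=set0 -> C `<=` Q -> C `<=` algebra_seminorm ->
     Q (pointwise_inf C)) ->
  exists p, [/\ algebra_seminorm p, Q p &
    forall q, algebra_seminorm q -> Q q -> (forall x, q x <= p x) ->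
      forall x, p x <= q x].
Proof.
move=> p0P Qp0 Qinf.
pose T := {p : A -> R | algebra_seminorm p /\ Q p}.
pose t0 : T := exist _ p0 (conj p0P Qp0).
pose le (s t : T) : bool := `[< forall x, sval t x <= sval s x >].
have [|||t tmax] := @ZL_preorder T t0 le.
- by move=> t; apply/asboolP.
- move=> r s t /asboolP rs /asboolP st; apply/asboolP => x.
  exact: le_trans (st x) (rs x).
- move=> D Dtot; have [[d Dd]|D0] := pselect (D !=set0); last first.
    by exists t0 => s Ds; case: D0; exists s.
  pose C := [set sval s | s in D].
  have C0 : C !=set0 by exists (sval d); exists d.
  have CP : C `<=` algebra_seminorm by move=> _ [s _ <-]; case: (svalP s).
  have CQ : C `<=` Q by move=> _ [s _ <-]; case: (svalP s).
  have infP : algebra_seminorm (pointwise_inf C).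
    apply: chain_pointwise_inf => // _ _ [s Ds <-] [t Dt <-].
    by have [/asboolP|/asboolP] := Dtot s t Ds Dt; [right|left].
  exists (exist _ (pointwise_inf C) (conj infP (Qinf _ C0 CQ CP))) => s Ds.
  by apply/asboolP => x; apply: pointwise_inf_le => //; exists s.
exists (sval t); have [tP tQ] := svalP t; split=> // q qP Qq qt x.
have /(_ _)/asboolP := tmax (exist _ q (conj qP Qq)); apply => //.
exact/asboolP.
Qed.

(** The condition imposed on [q] is [p y * q x <= q (y * x)] for all [x]: unlike the mere equality
    at [y], it survives localisation at any [f]. A minimal [q] thus lies below its own
    localisations, whose quotient of index 1 gives [q f * q x <= q (f * x)]. *)
Lemma minimal_mult_seminorm (p : A -> R) (y : A) :
  algebra_seminorm p -> exists q, [/\ algebra_seminorm q,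
    forall x z, q (x * z) = q x * q z, forall x, q x <= p x & q y = p y].
Proof.
move=> pP.
pose Q : set (A -> R) := [set q | (forall x, q x <= p x) /\
  forall x, p y * q x <= q (y * x)].
have [p0 [p0P Qp0]] : exists p0, algebra_seminorm p0 /\ Q p0.
  have [y0|y0] := eqVneq (p y) 0.
    by exists p; split=> //; split=> // x; rewrite y0 mul0r (asn_ge0 pP).
  have y_gt0 : 0 < p y by rewrite lt_def y0 (asn_ge0 pP).
  exists (asn_loc p y); split; first exact: asn_loc_seminorm.
  split=> x.
    by have := asn_loc_le pP y_gt0 0 x; rewrite /asn_quot !expr0 mul1r divr1.
  apply: le_asn_loc => // n; rewrite asn_quot_mulf// ler_pM2l//.
  exact: asn_loc_le.
have [//|//||q [qP [qp qy] qmin]] := @minimal_seminorm Q p0.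
  move=> C C0 CQ CP; split=> x.
    case: (C0) => q Cq; apply: le_trans (pointwise_inf_le _ CP Cq) _.
    by case: (CQ _ Cq).
  apply: le_pointwise_inf => // q Cq; have [_ /(_ x)] := CQ _ Cq.
  by apply: le_trans; rewrite ler_wpM2l ?(asn_ge0 pP)// pointwise_inf_le.
exists q; split=> //; last first.
  apply/eqP; rewrite eq_le qp /=; have := qy 1.
  by rewrite (asn1 qP) !mulr1.
move=> f x; apply/eqP; rewrite eq_le (asnM qP) /=.
have [f0|f0] := eqVneq (q f) 0; first by rewrite f0 mul0r (asn_ge0 qP).
have f_gt0 : 0 < q f by rewrite lt_def f0 (asn_ge0 qP).
have locle z : asn_loc q f z <= q z.
  by have := asn_loc_le qP f_gt0 0 z; rewrite /asn_quot !expr0 mul1r divr1.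
have locP := asn_loc_seminorm A_comm qP f_gt0.
have qloc z : q z <= asn_loc q f z.
  apply: qmin => //; split=> [w|w]; first exact: le_trans (locle w) (qp w).
  apply: le_asn_loc => // n.
  apply: le_trans (ler_wpM2l (asn_ge0 pP y) (asn_loc_le qP f_gt0 n w)) _.
  by rewrite /asn_quot [X in X <= _]mulrA ler_pM2r ?invr_gt0 ?exprn_gt0//
    mulrCA qy.
have := asn_loc_le qP f_gt0 1 x; rewrite /asn_quot !expr1 ler_pdivlMr//.
by rewrite mulrC; apply: le_trans; rewrite ler_wpM2l ?(asn_ge0 qP).
Qed.
End Minimal.

(** * The Gelfand-Mazur theorem for multiplicative seminorms *)

Section Characters.
Context {R : realType} {A : cstarAlgType R}.
Hypothesis A_comm : commutative (fun x y : A => x * y).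
#[local] HB.instance Definition _ :=
  GRing.PzRing_hasCommutativeMul.Build (CstarAlgebra.sort A) A_comm.

Lemma asn0 (q : A -> R) : algebra_seminorm q -> q 0 = 0.
Proof. by move=> qP; rewrite -(scale0r (0 : A)) (asnZ qP) nrm0 mul0r. Qed.

Lemma asnN (q : A -> R) x : algebra_seminorm q -> q (- x) = q x.
Proof. by move=> qP; rewrite -scaleN1r (asnZ qP) nrmN nrm1 mul1r. Qed.

Lemma asnB (q : A -> R) x y : algebra_seminorm q -> q (x - y) <= q x + q y.
Proof. by move=> qP; rewrite -(asnN y qP) (asnD qP). Qed.

Lemma asn_scalar (q : A -> R) c : algebra_seminorm q ->
  q (c *: (1 : A)) = nrm c.
Proof. by move=> qP; rewrite (asnZ qP) (asn1 qP) mulr1. Qed.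

Section GelfandMazur.
Variable q : A -> R.
Hypotheses (qP : algebra_seminorm q) (qM : forall x y, q (x * y) = q x * q y).

Let algE (c d : R[i]) : (c *: (1 : A)) * (d *: (1 : A)) = (c * d) *: (1 : A).
Proof. by rewrite -scalerAlA mul1r scalerA. Qed.

Let expr2k (x : A) k : x ^+ (2 ^ k.+1) = x ^+ (2 ^ k) * x ^+ (2 ^ k).
Proof. by rewrite expnS mul2n -addnn exprD. Qed.

Section Gap.
Variables (x : A) (m : R).
Hypotheses (m0 : 0 < m) (qm : forall c, m <= q (x - c *: (1 : A))).

(* Over the complex numbers [x ^+ (2 ^ k) - c] is a product of factors
   [x - c']. *)
Lemma asn_gap_pow k c : m ^+ (2 ^ k) <= q (x ^+ (2 ^ k) - c *: (1 : A)).
Proof.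
elim: k c => [|k IH] c; first by rewrite expn0 !expr1.
rewrite expr2k (_ : _ - _ = (x ^+ (2 ^ k) - sqrtc c *: (1 : A)) *
    (x ^+ (2 ^ k) - (- sqrtc c) *: (1 : A))); last first.
  by rewrite scaleNr -[c in LHS]sqr_sqrtc expr2 -algE; ring.
rewrite qM expnS mul2n -addnn exprD.
by rewrite ler_pM ?exprn_ge0// ltW.
Qed.

(** The cofactor of x - w in x^(2^k) - w^(2^k) is bounded below by m^(2^k - 1). *)
Lemma asn_gap_factor k w :
  q (x - w *: (1 : A)) * m ^+ (2 ^ k) <= m * q (x ^+ (2 ^ k) - (w ^+ (2 ^ k))
    *: (1 : A)).
Proof.
elim: k => [|k IH]; first by rewrite expn0 !expr1 mulrC.
have -> : x ^+ (2 ^ k.+1) - w ^+ (2 ^ k.+1) *: (1 : A) =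
    (x ^+ (2 ^ k) - w ^+ (2 ^ k) *: (1 : A)) *
    (x ^+ (2 ^ k) - (- w ^+ (2 ^ k)) *: (1 : A)).
  by rewrite !expnS !mul2n -!addnn !exprD scaleNr -algE; ring.
rewrite qM expnS mul2n -addnn exprD !mulrA.
rewrite ler_pM ?mulr_ge0 ?(asn_ge0 qP) ?exprn_ge0 ?(ltW m0)//.
exact: asn_gap_pow.
Qed.

Lemma asn_gap_upper k w :
  q (x - w *: (1 : A)) * m ^+ (2 ^ k) <= m * (q x ^+ (2 ^ k) + nrm w ^+ (2 ^
    k)).
Proof.
apply: le_trans (asn_gap_factor k w) _; rewrite ler_pM2l//.
apply: le_trans (asnB _ _ qP) _; rewrite asn_scalar// nrmX lerD2r.
by elim: (2 ^ k)%N => [|n IH]; rewrite ?expr0 ?(asn1 qP)//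
  !exprS qM ler_wpM2l ?(asn_ge0 qP).
Qed.
End Gap.

Lemma ler_exprD1 (e : R) n : 0 <= e -> e <= 1 -> (1 + e) ^+ n <= 1 + 3 ^+ n * e.
Proof.
move=> e0 e1; elim: n => [|n IH]; first by rewrite !expr0 mul1r lerDl.
rewrite exprS; apply: le_trans (ler_wpM2l _ IH) _; first by rewrite addr_ge0.
have : 1 <= (3 : R) ^+ n by rewrite exprn_ege1// ler1n.
rewrite exprS; move: (3 ^+ n : R) => c c1.
have h1 : e <= c * e by rewrite ler_peMl.
have h2 : c * e * e <= c * e by rewrite ler_piMr// mulr_ge0// (le_trans ler01).
lra.
Qed.

Lemma exp2V_lt (e : R) : 0 < e -> exists k, ((2 : R) ^+ (2 ^ k))^-1 <= e.
Proof.
move=> e0; have := @archi_boundP _ e^-1 (ltW _); rewrite invr_gt0 => /(_ e0).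
set k := Num.bound _ => ek; exists k.
rewrite -[X in _ <= X]invrK lef_pV2 ?posrE ?invr_gt0 ?exprn_gt0//.
rewrite (le_trans (ltW ek))// -natrX ler_nat.
by rewrite ltnW// (ltn_trans (ltn_expl k (ltnSn 1)))// ltn_expl.
Qed.

(** If the distance m from x to the scalars were positive, the power estimate would keep [q] almost
    equal to m on the disc of radius m / 2 around a near-minimiser. Repeating this carries the bound
    2 m out to distance 5 m, where the triangle inequality forces at least 3 m. *)
Lemma gelfand_mazur (x : A) : exists c, q (x - c *: (1 : A)) = 0.
Proof.
pose S := [set q (x - c *: (1 : A)) | c in [set: R[i]]].
have S_inf : has_inf S.
  split; first by exists (q (x - 0 *: (1 : A))); exists 0.
  by exists 0 => _ [c _ <-]; exact: asn_ge0.
pose m := inf S.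
have qm c : m <= q (x - c *: (1 : A)) by apply: ge_inf; [case: S_inf|exists c].
have m_ge0 : 0 <= m.
  by apply: lb_le_inf; [case: S_inf|move=> _ [c _ <-]; exact: asn_ge0].
have translate (y z : R[i]) : x - (y + z) *: (1 : A) = (x - y *: (1 : A)) - z
  *: (1 : A).
  by rewrite scalerDl opprD addrA.
have [m0|m_neq0] := eqVneq m 0.
  (* The infimum 0 has to be attained. The intervals of radius [q (x - d)] about [f d] meet
     pairwise, hence have a common point; those for the real and the imaginary part form the
     required scalar. *)
  have loc (f : R[i] -> R) : (forall c d, f c - f d <= nrm (c - d)) ->
      exists a, forall d, `|f d - a| <= q (x - d *: (1 : A)).
    move=> f_lip; pose F := [set f c - q (x - c *: (1 : A)) | c in [set: R[i]]].
    have le c d : f c - q (x - c *: (1 : A)) <= f d + q (x - d *: (1 : A)).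
      have := f_lip c d; have : nrm (c - d) <= q (x - d *: (1 : A)) + q (x - c
        *: (1 : A)).
        rewrite -(asn_scalar (c - d) qP).
        rewrite (_ : _ *: _ = (x - d *: (1 : A)) - (x - c *: (1 : A))) ?asnB//.
        by rewrite scalerBl; ring.
      lra.
    have F0 : F !=set0 by exists (f 0 - q (x - 0 *: (1 : A))); exists 0.
    exists (sup F) => d; rewrite ler_norml; apply/andP; split.
      rewrite lerBrDr addrC -lerBrDr opprK; apply: ge_sup => // _ [c _ <-].
      exact: le.
    rewrite lerBlDr -lerBlDl; apply: ub_le_sup; last by exists d.
    by exists (f 0 + q (x - 0 *: (1 : A))) => _ [c _ <-]; exact: le.
  have [a ha] : exists a, forall d, `|complex.Re d - a| <= q (x - d *: (1 : A)).
    apply: loc => c d; rewrite (le_trans _ (nrm_ge_Re _))//.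
    by rewrite (le_trans (ler_norm _))// raddfB.
  have [b hb] : exists b, forall d, `|complex.Im d - b| <= q (x - d *: (1 : A)).
    apply: loc => c d; rewrite (le_trans _ (nrm_ge_Im _))//.
    by rewrite (le_trans (ler_norm _))// raddfB.
  exists (a +i* b); apply/eqP; rewrite eq_le (asn_ge0 qP) andbT.
  apply/ler_addgt0Pr => e e0; rewrite add0r.
  have e30 : 0 < e / 3 by rewrite divr_gt0.
  have [_ [d _ <-]] := inf_adherent e30 S_inf; rewrite -/m m0 add0r => hd.
  have : q (x - (a +i* b) *: (1 : A)) <= q (x - d *: (1 : A)) + nrm (d - (a +i*
    b)).
    rewrite -(asn_scalar (d - _) qP).
    rewrite (_ : x - _ = (x - d *: (1 : A)) + (d - (a +i* b)) *: (1 : A))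
      ?asnD//.
    by rewrite scalerBl; ring.
  have := nrm_le_ReIm (d - (a +i* b)); have := ha d; have := hb d.
  by rewrite !raddfB /=; lra.
have m0 : 0 < m by rewrite lt_def m_neq0.
have step e' : 0 < e' -> exists2 e, 0 < e & forall l w,
    q (x - l *: (1 : A)) <= m * (1 + e) -> nrm w <= m / 2 ->
    q (x - (l + w) *: (1 : A)) <= m * (1 + e').
  move=> e'0; have e'20 : 0 < e' / 2 by rewrite divr_gt0.
  have [k hk] := exp2V_lt e'20; set N := (2 ^ k)%N in hk.
  (* This [e] pays for (1 + e)^N <= 1 + 3^N e; the contribution 2^(-N) of [w] is paid for by the
     choice of k. *)
  pose e := Num.min 1 (e' / 2 / 3 ^+ N).
  have e0 : 0 < e by rewrite lt_min ltr01 divr_gt0// exprn_gt0.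
  have e1 : e <= 1 by rewrite ge_min lexx.
  have eN : 3 ^+ N * e <= e' / 2.
    by rewrite mulrC -ler_pdivlMr ?exprn_gt0// ge_min lexx orbT.
  exists e => // l w hl hw.
  rewrite translate -(ler_pM2r (exprn_gt0 N m0)).
  have gap c : m <= q (x - l *: (1 : A) - c *: (1 : A)) by rewrite -translate
    qm.
  apply: le_trans (asn_gap_upper m0 gap k w) _; rewrite -/N -!mulrA ler_pM2l//.
  have -> : (1 + e') * m ^+ N = (1 + e' / 2) * m ^+ N + e' / 2 * m ^+ N by
    field.
  apply: lerD.
    have := asn_ge0 qP (x - l *: (1 : A)); move: (q _) hl => t hl t0.
    have : t ^+ N <= (m * (1 + e)) ^+ N.
      by rewrite lerXn2r ?nnegrE// mulr_ge0 ?addr_ge0 ?ltW.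
    move=> /le_trans; apply; rewrite exprMn mulrC ler_wpM2r ?exprn_ge0//.
    by apply: le_trans (ler_exprD1 N (ltW e0) e1) _; rewrite lerD2l.
  have : nrm w ^+ N <= (m / 2) ^+ N.
    by rewrite lerXn2r ?nnegrE ?nrm_ge0// divr_ge0 ?ltW.
  move=> /le_trans; apply; rewrite exprMn exprVn mulrC.
  by rewrite ler_wpM2r ?exprn_ge0.
have reach K e' : 0 < e' -> exists2 e, 0 < e & forall l w,
    q (x - l *: (1 : A)) <= m * (1 + e) -> nrm w <= K%:R * (m / 2) ->
    q (x - (l + w) *: (1 : A)) <= m * (1 + e').
  elim: K e' => [|K IH] e' e'0.
    exists e' => // l w hl; rewrite mul0r => w0.
    by rewrite (@nrm_eq0 _ _ w) ?addr0//; apply/eqP; rewrite eq_le w0 nrm_ge0.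
  have [e1 e10 h1] := step _ e'0; have [e e0 h] := IH _ e10.
  exists e => // l w hl hw.
  (* The translation by [w] is cut into [a w], covered by K steps, and one last step [b w] of length
     at most m / 2. *)
  pose a : R := K%:R / K.+1%:R; pose b : R := K.+1%:R^-1.
  have K1 : 0 < K.+1%:R :> R by rewrite ltr0n.
  have ab : a + b = 1 by rewrite /a /b -[X in _ + X]mul1r -mulrDl natr1 divff
    ?gt_eqF.
  have -> : l + w = (l + a%:C * w) + b%:C * w.
    by rewrite -addrA -mulrDl -rmorphD ab mul1r.
  apply: h1; last first.
    rewrite nrmM nrmC ger0_norm ?invr_ge0 ?ler0n//.
    by rewrite /b ler_pdivrMl.
  apply: h => //; rewrite nrmM nrmC ger0_norm ?divr_ge0 ?ler0n//.
  by rewrite /a -mulrA ler_wpM2l ?ler0n// ler_pdivrMl.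
(* Ten steps of length m / 2 reach distance 5 m. *)
have [e e0 he] := reach 10%N 1 ltr01.
have me : 0 < m * e by rewrite mulr_gt0.
have [_ [l _ <-] hl] := inf_adherent me S_inf.
have hl' : q (x - l *: (1 : A)) <= m * (1 + e) by rewrite mulrDr mulr1 ltW.
have := he l (5 * m)%:C hl'; rewrite nrmC ger0_norm ?mulr_ge0//.
have -> : 5 * m <= 10%:R * (m / 2) by lra.
move=> /(_ isT).
have := he l 0 hl'; rewrite nrm0 addr0 => {}he.
have h0 : q (x - l *: (1 : A)) <= m * 2 by apply: he;
  rewrite mulr_ge0 ?divr_ge0.
rewrite translate => h2; have := asnB (x - l *: (1 : A)) (x - l *: (1 : A) - (5
  * m)%:C *: (1 : A)) qP.
rewrite opprB addrC subrK asn_scalar// nrmC ger0_norm ?mulr_ge0//.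
lra.
Qed.

End GelfandMazur.
End Characters.

(** * Characters *)

Section CharacterTheory.
Context {R : realType} {A : cstarAlgType R}.
Hypothesis A_comm : commutative (fun x y : A => x * y).
#[local] HB.instance Definition _ :=
  GRing.PzRing_hasCommutativeMul.Build (CstarAlgebra.sort A) A_comm.

Record character (chi : A -> R[i]) : Prop := Character {
  charD : forall x y, chi (x + y) = chi x + chi y ;
  charZ : forall c x, chi (c *: x) = c * chi x ;
  charM : forall x y, chi (x * y) = chi x * chi y ;
  char1 : chi 1 = 1 ;
  char_le : forall x, nrm (chi x) <= nrm x }.

(** The scalar at [q]-distance 0 from [x] is unique, so it depends on [x] as a homomorphism, whose
    modulus is [q]. *)
Lemma char_norming (p : A -> R) y : algebra_seminorm p ->
  exists chi, [/\ character chi, forall x, nrm (chi x) <= p x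
    & nrm (chi y) = p y].
Proof.
move=> pP; have [q [qP qM qp qy]] := minimal_mult_seminorm A_comm y pP.
have /choice[chi chiP] := gelfand_mazur A_comm qP qM.
have uniq x c : q (x - c *: (1 : A)) = 0 -> chi x = c.
  move=> xc; apply/eqP; rewrite -subr_eq0; apply/eqP/nrm_eq0/eqP.
  rewrite eq_le nrm_ge0 andbT -(asn_scalar (A := A) _ qP).
  rewrite (_ : _ *: _ = (x - c *: (1 : A)) - (x - chi x *: (1 : A))).
    by rewrite (le_trans (asnB _ _ qP))// xc chiP addr0.
  by rewrite scalerBl; ring.
have le0 x : q x <= 0 -> q x = 0.
  by move=> ?; apply/eqP; rewrite eq_le (asn_ge0 qP) andbT.
have qE x : q x = nrm (chi x).
  apply/eqP; rewrite eq_le -(asn_scalar _ qP); apply/andP; split.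
    have := asnD qP (x - chi x *: (1 : A)) (chi x *: (1 : A)).
    by rewrite subrK chiP add0r.
  have := asnB x (x - chi x *: (1 : A)) qP.
  by rewrite opprB addrC subrK chiP addr0.
exists chi; split; last by rewrite -qE.
  split.
  - move=> x z; apply: uniq; apply: le0.
    rewrite (_ : _ - _ = (x - chi x *: (1 : A)) + (z - chi z *: (1 : A))).
      by rewrite (le_trans (asnD qP _ _))// !chiP addr0.
    by rewrite scalerDl; ring.
  - move=> c x; apply: uniq; rewrite -scalerA -scalerBr (asnZ qP) chiP.
    by rewrite mulr0.
  - move=> x z; apply: uniq; apply: le0.
    rewrite (_ : _ - _ = (x - chi x *: (1 : A)) * z +
        chi x *: (z - chi z *: (1 : A))).
      by rewrite (le_trans (asnD qP _ _))//
        (asnZ qP) qM !chiP mul0r mulr0 addr0.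
    by rewrite mulrBl -scalerAlA mul1r scalerBr scalerA; ring.
  - by apply: uniq; rewrite scale1r subrr asn0.
  - by move=> x; rewrite -qE (le_trans (qp x))// (asn_le pP).
by move=> x; rewrite -qE.
Qed.

Section OneCharacter.
Variable chi : A -> R[i].
Hypothesis chiP : character chi.

Lemma charN x : chi (- x) = - chi x.
Proof. by rewrite -scaleN1r (charZ chiP) mulN1r. Qed.

Lemma charB x y : chi (x - y) = chi x - chi y.
Proof. by rewrite (charD chiP) charN. Qed.

Lemma charX x n : chi (x ^+ n) = chi x ^+ n.
Proof.
by elim: n => [|n IH]; rewrite ?expr0 ?(char1 chiP)// !exprS (charM chiP) IH.
Qed.

Lemma char_scalar c : chi (c *: (1 : A)) = c.
Proof. by rewrite (charZ chiP) (char1 chiP) mulr1. Qed.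

(* Arens' trick: the values on the vertical line through [h] grow too fast
   unless [chi h] is real. *)
Lemma char_selfadj h : star h = h -> complex.Im (chi h) = 0.
Proof.
move=> hsa; have key (s : R) :
    complex.Im (chi h) ^+ 2 + 2 * complex.Im (chi h) * s <= nrm h ^+ 2.
  have := char_le chiP (h + (0 +i* s) *: (1 : A)).
  rewrite -(@ler_pXn2r _ 2) ?nnegrE ?nrm_ge0//.
  rewrite sqr_nrmE (charD chiP) char_scalar. rewrite -[nrm (h + _) ^+
    2]nrm_star_mul starD starZ star1 hsa.
  rewrite (_ : _ * _ = h * h + (s ^+ 2)%:C *: (1 : A)); last first.
    have -> : (0 +i* s : R[i])^* = - (0 +i* s) by apply/eqP;
      rewrite eq_complex /= oppr0 !eqxx.
    have -> : (s ^+ 2)%:C = - ((0 +i* s) * (0 +i* s)).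
      by apply/eqP; rewrite eq_complex /=; apply/andP; split; apply/eqP; ring.
    rewrite scaleNr [(- _) *: _]scaleNr -[(_ * _) *: _]scalerA.
    set c : R[i] := 0 +i* s.
    have -> : c *: (c *: (1 : A)) = (c *: (1 : A)) * (c *: (1 : A)) by rewrite
      -scalerAlA mul1r.
    ring.
  move=> le; have := le_trans le (ler_nrmD _ _).
  rewrite nrm_sqr// nrmZ nrmC ger0_norm ?sqr_ge0//.
  have : nrm (1 : A) <= 1.
    have [->|/eqP/(nrm1A A_comm) ->//] := eqVneq (1 : A) 0.
    by rewrite nrm0 ler01.
  rewrite !raddfD /= !addr0.
  move: (nrm _) (nrm _) (complex.Re _) (complex.Im _) => u v a b.
  have := sqr_ge0 s; have := sqr_ge0 a; nra.
set b := complex.Im _ in key *; apply/eqP; apply: contraT => b0.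
have := key ((nrm h ^+ 2 + 1) / (2 * b)).
rewrite mulrC divfK ?mulf_neq0//.
have := sqr_ge0 b; lra.
Qed.

Lemma char_star x : chi (star x) = (chi x)^*.
Proof.
have h1 := @char_selfadj (x + star x).
have h2 := @char_selfadj ((0 +i* 1) *: (x - star x)).
have {h1}: complex.Im (chi x + chi (star x)) = 0.
  by rewrite -(charD chiP) h1// starD starK addrC.
have {h2}: complex.Im ((0 +i* 1) * (chi x - chi (star x))) = 0.
  rewrite -charB -(charZ chiP) h2// starZ starB starK.
  have -> : (0 +i* 1 : R[i])^* = - (0 +i* 1) by apply/eqP;
    rewrite eq_complex /= oppr0 !eqxx.
  by rewrite scaleNr -scalerN opprB.
case: (chi x) (chi (star x)) => [a b] [c d] /=.
rewrite /= mul0r mul1r => e1 e2.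
by apply/eqP; rewrite eq_complex /=; lra.
Qed.
End OneCharacter.

(** The zero algebra has no characters; [0 <= c] covers it. *)
Lemma nrm_char_le (x : A) c : 0 <= c ->
  (forall chi, character chi -> nrm (chi x) <= c) -> nrm x <= c.
Proof.
move=> c0 le; have [A0|/eqP A1] := eqVneq (1 : A) 0.
  by rewrite -[x]mulr1 A0 mulr0 nrm0.
have [chi [chiP _ <-]] := char_norming x (nrm_algebra_seminorm A_comm A1).
exact: le.
Qed.

Lemma char_spectrum (t : A) chi : character chi -> spectrum t (chi t).
Proof.
move=> chiP [s [st _]]; have /eqP := congr1 chi st.
by rewrite (charM chiP) charB// char_scalar//
  subrr mulr0 (char1 chiP) eq_sym oner_eq0.
Qed.
End CharacterTheory.

(** * The Stone-Weierstrass theorem *)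

Section StoneWeierstrass.
Context {R : realType} {A : cstarAlgType R}.
Hypothesis A_comm : commutative (fun x y : A => x * y).
#[local] HB.instance Definition _ :=
  GRing.PzRing_hasCommutativeMul.Build (CstarAlgebra.sort A) A_comm.

Lemma closed_nrm_dist (B : set A) s : closed B -> ~ B s ->
  exists2 d : R, 0 < d & forall b, B b -> d <= nrm (s - b).
Proof.
move=> Bcl Bs; have : nbhs s (~` B) by apply: open_nbhs_nbhs; split=> //;
  exact: closed_openC.
rewrite -nbhs_ballE => -[e /= e0 eB]; exists (complex.Re e).
  by move: e0; rewrite ltcE /= => /andP[].
move=> b Bb; rewrite leNgt; apply/negP => lt; apply: (eB b) => //.
rewrite -ball_normE /=; rewrite nrmE -[e]RRe_real ?ltcR// realE ltW//.
Qed.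

Section Subalgebra.
Variable B : set A.
Hypotheses (BP : cstar_subalgebra B) (B1 : B 1).

Lemma subalgZ c x : B x -> B (c *: x).
Proof. by case: BP => B0 lin _ _ _ Bx; rewrite -[_ *: _]addr0; exact: lin. Qed.

Lemma subalgD x y : B x -> B y -> B (x + y).
Proof. by case: BP => _ lin _ _ _ Bx By; rewrite -[x]scale1r; exact: lin. Qed.

Lemma subalgB x y : B x -> B y -> B (x - y).
Proof.
move=> Bx By; rewrite -scaleN1r; apply: subalgD => //; exact: subalgZ.
Qed.

Lemma subalgM x y : B x -> B y -> B (x * y).
Proof. by case: BP => _ _ h _ _; exact: h. Qed.

Lemma subalg_star x : B x -> B (star x).
Proof. by case: BP => _ _ _ h _; exact: h. Qed.

Lemma subalgX x n : B x -> B (x ^+ n).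
Proof.
move=> Bx; elim: n => [|n IH]; first by rewrite expr0.
by rewrite exprS; apply: subalgM.
Qed.
End Subalgebra.

Definition char_sup (F : set (A -> R[i])) (x : A) : R :=
  sup [set nrm (chi x) | chi in F].

Section CharSup.
Variables (p : A -> R) (F : set (A -> R[i])).
Hypotheses (F0 : F !=set0) (FP : F `<=` character)
  (Fp : forall chi x, F chi -> nrm (chi x) <= p x).

Lemma char_sup_ge chi x : F chi -> nrm (chi x) <= char_sup F x.
Proof.
move=> Fchi; apply: ub_le_sup; last by exists chi.
by exists (p x) => _ [chi' /Fp ? <-].
Qed.

Lemma char_sup_le x c : (forall chi, F chi -> nrm (chi x) <= c) ->
  char_sup F x <= c.
Proof.
move=> le; apply: ge_sup; last by move=> _ [chi ? <-]; exact: le.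
by case: F0 => chi ?; exists (nrm (chi x)); exists chi.
Qed.

Lemma char_sup_seminorm : algebra_seminorm (char_sup F).
Proof.
have ge0 x : 0 <= char_sup F x.
  by case: F0 => chi Fchi; apply: le_trans (char_sup_ge x Fchi); exact: nrm_ge0.
split=> //.
- move=> x y; apply: char_sup_le => chi Fchi; rewrite (charD (FP Fchi)).
  by rewrite (le_trans (ler_nrmD _ _))// lerD ?char_sup_ge.
- move=> c x; apply/eqP; rewrite eq_le; apply/andP; split.
    apply: char_sup_le => chi Fchi; rewrite (charZ (FP Fchi)) nrmM.
    by rewrite ler_wpM2l ?nrm_ge0 ?char_sup_ge.
  have [->|c0] := eqVneq (nrm c) 0; first by rewrite mul0r.
  have c_gt0 : 0 < nrm c by rewrite lt_def c0 nrm_ge0.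
  rewrite -ler_pdivlMl//; apply: char_sup_le => chi Fchi.
  by rewrite ler_pdivlMl// -nrmM -(charZ (FP Fchi)) char_sup_ge.
- move=> x y; apply: char_sup_le => chi Fchi; rewrite (charM (FP Fchi)) nrmM.
  by rewrite ler_pM ?nrm_ge0 ?char_sup_ge.
- move=> x; apply/eqP; rewrite eq_le; apply/andP; split.
    apply: char_sup_le => chi Fchi; rewrite (charM (FP Fchi)) nrmM -expr2.
    by rewrite lerXn2r ?nnegrE ?nrm_ge0 ?char_sup_ge.
  rewrite -[X in _ <= X]sqr_sqrtr// lerXn2r ?nnegrE ?sqrtr_ge0//.
  apply: char_sup_le => chi Fchi.
  rewrite -[X in X <= _]ger0_norm ?nrm_ge0// -sqrtr_sqr ler_wsqrtr//.
  by rewrite expr2 -nrmM -(charM (FP Fchi)) char_sup_ge.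
- apply/eqP; rewrite eq_le; apply/andP; split.
    by apply: char_sup_le => chi Fchi; rewrite (char1 (FP Fchi)) nrm1.
  by case: F0 => chi Fchi; rewrite -(@nrm1 R) -(char1 (FP Fchi)) char_sup_ge.
- by move=> x; apply: char_sup_le => chi Fchi; rewrite (char_le (FP Fchi)).
Qed.
End CharSup.

Lemma bernoulli_ge (x : R) N : 0 <= x <= 1 -> 1 - N%:R * x <= (1 - x) ^+ N.
Proof.
move=> /andP[x0 x1]; elim: N => [|N IH]; first by rewrite mul0r subr0 expr0.
have x1' : 0 <= 1 - x by rewrite subr_ge0.
rewrite exprS; apply: le_trans _ (ler_wpM2l x1' IH); rewrite -natr1.
have : 0 <= N%:R * x * x :> R by rewrite !mulr_ge0.
lra.
Qed.

Lemma bernoulli_le (x : R) N : 0 <= x <= 1 ->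
  (1 - x) ^+ N * (1 + N%:R * x) <= 1.
Proof.
move=> /andP[x0 x1]; elim: N => [|N IH]; first by rewrite mul0r addr0 expr0
  mul1r.
have x1' : 0 <= 1 - x by rewrite subr_ge0.
apply: le_trans IH; rewrite exprS -mulrA mulrCA ler_wpM2l ?exprn_ge0//.
rewrite -natr1; have : 0 <= N%:R * x * x :> R by rewrite !mulr_ge0.
have := sqr_ge0 x; lra.
Qed.

Lemma exp_vanish (q c e : R) : 0 <= q -> q < 1 -> 0 < e ->
  exists n, q ^+ n * c < e.
Proof.
move=> q0 q1 e0; have q_cvg : q ^+ n @[n --> \oo] --> (0 : R).
  by apply: cvg_expr; rewrite ger0_norm.
have c0 : 0 < `|c| + 1 by rewrite ltr_wpDl.
have /cvgrPdist_lt/(_ (e / (`|c| + 1)) (divr_gt0 e0 c0)) [N _ /(_ N (leqnn _))]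
  := q_cvg.
rewrite /= sub0r normrN normrX ger0_norm// ltr_pdivlMr// => lt.
exists N; apply: le_lt_trans lt; rewrite ler_wpM2l ?exprn_ge0//.
by rewrite (le_trans (ler_norm _))// lerDl.
Qed.

(* Machado-Ransford: a seminorm minimal among those keeping [s] at distance
   [d] from [B] cannot see two different values of a selfadjoint [h] in [B],
   since otherwise it would be the maximum of two strictly smaller seminorms,
   for which [s] has close approximants in [B], and these can be glued together
   by means of [(1 - h ^+ n) ^+ (2 ^ n)]. *)
Lemma minimal_seminorm_selfadj (B : set A) (p : A -> R) (s : A) (d : R) :
  cstar_subalgebra B -> B 1 -> algebra_seminorm p ->
  (forall b, B b -> d <= p (s - b)) ->
  (forall q, algebra_seminorm q -> (forall b, B b -> d <= q (s - b)) ->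
     (forall x, q x <= p x) -> forall x, p x <= q x) ->
  forall h, B h -> star h = h ->
    (forall chi, character chi -> (forall x, nrm (chi x) <= p x) ->
      0 <= complex.Re (chi h) <= 1) ->
    p h = 1 -> p (1 - h) = 1 -> False.
Proof.
move=> BP B1 pP ps pmin h Bh hsa h01 ph p1h.
pose F : set (A -> R[i]) :=
  [set chi | character chi /\ forall x, nrm (chi x) <= p x].
have FhE chi : F chi -> chi h = (complex.Re (chi h))%:C.
  case=> chiP _; have := char_selfadj A_comm chiP hsa.
  by case: (chi h) => a b /= ->.
(* The supremum over the characters in the region [P] is a seminorm below [p] and strictly smaller
   at [x]; by minimality it lets some element of [B] come closer to [s] than [d]. *)
have close (P : set R) (x : A) (c : R) : c < 1 -> p x = 1 ->
    (forall chi, F chi -> P (complex.Re (chi h)) -> nrm (chi x) <= c) ->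
    exists b e, [/\ B b, e < d & forall chi, F chi -> P (complex.Re (chi h)) ->
      nrm (chi (s - b)) <= e].
  move=> c1 px hx; pose F' := [set chi | F chi /\ P (complex.Re (chi h))].
  have [F'0|F'0] := pselect (F' !=set0); last first.
    exists 0, (d - 1); split; [by case: BP|by rewrite gtrBl|].
    by move=> chi Fchi Pchi; case: F'0; exists chi.
  have F'P : F' `<=` character by move=> chi [[]].
  have F'p chi y : F' chi -> nrm (chi y) <= p y by case=> -[_ ?] _.
  have qle x' : char_sup F' x' <= p x' by apply: char_sup_le => // chi /F'p.
  have /existsNP[b /not_implyP[Bb /negP]] :
      ~ forall b, B b -> d <= char_sup F' (s - b).
    move=> /(pmin _ (char_sup_seminorm F'0 F'P F'p))/(_ qle)/(_ x).
    rewrite px leNgt => /negP; apply; apply: le_lt_trans c1.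
    by apply: char_sup_le => // chi [Fchi Pchi]; exact: hx.
  rewrite -ltNge => lt; exists b, (char_sup F' (s - b)); split=> //.
  by move=> chi Fchi Pchi; apply: (char_sup_ge F'p).
have [b1 [d1 [Bb1 d1d hb1]]] : exists b e, [/\ B b, e < d & forall chi, F chi ->
    complex.Re (chi h) <= 2 / 3 -> nrm (chi (s - b)) <= e].
  apply: (close [set u | u <= 2 / 3] h (2 / 3)) => //; first by lra.
  move=> chi Fchi /= le; rewrite FhE// nrmC ger0_norm//.
  by case: Fchi => chiP chip; have /andP[] := h01 _ chiP chip.
have [b2 [d2 [Bb2 d2d hb2]]] : exists b e, [/\ B b, e < d & forall chi, F chi ->
    1 / 3 <= complex.Re (chi h) -> nrm (chi (s - b)) <= e].
  apply: (close [set u | 1 / 3 <= u] (1 - h) (2 / 3)) => //; first by lra.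
  move=> chi Fchi /= le; have := FhE _ Fchi; case: Fchi => chiP chip hE.
  rewrite charB// (char1 chiP) hE -[1]/(1%:C) -rmorphB nrmC ger0_norm.
    by lra.
  by have /andP[_] := h01 _ chiP chip; rewrite subr_ge0.
pose C := p (s - b1) + p (s - b2); pose dd := Num.max d1 d2.
have C0 : 0 <= C by rewrite addr_ge0 ?(asn_ge0 pP).
have ddd : dd < d by rewrite gt_max d1d d2d.
have [n hn] : exists n, (3 / 4) ^+ n * C < d - dd.
  by apply: exp_vanish; rewrite ?subr_gt0//; lra.
(* Where h has the value u, Bernoulli's inequalities put g between 1 - (2u)^n and 1 / (1 + (2u)^n):
   close to 1 for u < 1/3 and close to 0 for u > 2/3, while in between both approximants are good.
   The rate 3/4 exceeds 2/3 and is the inverse of 4/3. *)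
pose g := (1 - h ^+ n) ^+ (2 ^ n); pose k := g * b1 + (1 - g) * b2.
have Bg : B g by apply: subalgX => //; apply: subalgB => //; exact: subalgX.
have Bk : B k.
  by apply: subalgD => //; apply: subalgM => //; exact: subalgB.
have := ps _ Bk; rewrite leNgt => /negP; apply.
have [chi [chiP chip <-]] := char_norming A_comm (s - k) pP.
have Fchi : F chi by [].
have /andP[u0 u1] := h01 _ chiP chip; have hE := FhE _ Fchi.
set u := complex.Re (chi h) in hE u0 u1.
pose v := (1 - u ^+ n) ^+ (2 ^ n).
have un0 : 0 <= u ^+ n by exact: exprn_ge0.
have un1 : u ^+ n <= 1 by exact: exprn_ile1.
have v0 : 0 <= v by rewrite exprn_ge0// subr_ge0.
have v1 : v <= 1 by rewrite exprn_ile1 ?subr_ge0// gerBl.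
have gE : chi g = v%:C.
  by rewrite charX// charB// charX// (char1 chiP) hE rmorphXn rmorphB rmorphXn
    rmorph1.
have -> : chi (s - k) = v%:C * chi (s - b1) + (1 - v)%:C * chi (s - b2).
  rewrite (_ : s - k = g * (s - b1) + (1 - g) * (s - b2)); last by rewrite /k;
    ring.
  by rewrite (charD chiP (g * _)) !(charM chiP) [chi (1 - g)]charB//
    (char1 chiP) gE rmorphB rmorph1.
apply: le_lt_trans (ler_nrmD _ _) _; rewrite !nrmM !nrmC !ger0_norm ?subr_ge0//.
have c1 : nrm (chi (s - b1)) <= C by rewrite (le_trans (chip _))//
  lerDl (asn_ge0 pP).
have c2 : nrm (chi (s - b2)) <= C by rewrite (le_trans (chip _))//
  lerDr (asn_ge0 pP).
have x1_0 := nrm_ge0 (chi (s - b1)); have x2_0 := nrm_ge0 (chi (s - b2)).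
have dd1 : d1 <= dd by rewrite le_max lexx.
have dd2 : d2 <= dd by rewrite le_max lexx orbT.
have hb1' : u <= 2 / 3 -> nrm (chi (s - b1)) <= dd by move=> /(hb1 _
  Fchi)/le_trans; exact.
have hb2' : 1 / 3 <= u -> nrm (chi (s - b2)) <= dd by move=> /(hb2 _
  Fchi)/le_trans; exact.
move: (nrm (chi (s - b1))) (nrm (chi (s - b2))) c1 c2 x1_0 x2_0 hb1' hb2' => x1
  x2 c1 c2 x1_0 x2_0 hb1' hb2'.
have nE : (2 ^ n)%:R * u ^+ n = (2 * u) ^+ n by rewrite natrX exprMn.
have vge : 1 - (2 * u) ^+ n <= v by rewrite -nE bernoulli_ge// un0 un1.
have vle : v * (1 + (2 * u) ^+ n) <= 1 by rewrite -nE bernoulli_le// un0 un1.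
have [u13|u13] := ltP u (1 / 3).
  have x1d : x1 <= dd by apply: hb1'; lra.
  have : (2 * u) ^+ n <= (3 / 4) ^+ n.
    by apply: lerXn2r; rewrite ?nnegrE; lra.
  move: (_ ^+ n) (_ ^+ n) hn vge => w1 w2 hn vge ww.
  have : v * x1 <= x1 by rewrite ler_piMl.
  have : (1 - v) * x2 <= w2 * C by rewrite ler_pM ?subr_ge0//; lra.
  lra.
have x2d := hb2' u13.
have [u23|u23] := leP u (2 / 3).
  have x1d := hb1' u23.
  have : v * x1 <= v * dd by rewrite ler_wpM2l.
  have : (1 - v) * x2 <= (1 - v) * dd by rewrite ler_wpM2l// subr_ge0.
  lra.
have vn : v <= (3 / 4) ^+ n.
  have : (4 / 3) ^+ n <= (2 * u) ^+ n.
    by apply: lerXn2r; rewrite ?nnegrE; lra.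
  move=> le; rewrite (_ : 3 / 4 = (4 / 3 : R)^-1); last by rewrite invf_div.
  have p0 : 0 < (4 / 3 : R) ^+ n by rewrite exprn_gt0.
  rewrite exprVn -(ler_pM2r p0) mulVf ?gt_eqF//; apply: le_trans vle.
  by rewrite ler_wpM2l// (le_trans le)// lerDr.
have : v * x1 <= (3 / 4) ^+ n * C by rewrite ler_pM.
have : (1 - v) * x2 <= x2 by rewrite ler_piMl ?subr_ge0// gerBl.
lra.
Qed.

(** Only the value at the single element [s] has to be determined by [B]. Characters below a minimal
    seminorm agree on [B], hence at [s], so that [s] is at seminorm 0 from a scalar, which lies in
    [B]. *)
Theorem stone_weierstrass (B : set A) (s : A) :
  cstar_subalgebra B -> B 1 ->
  (forall chi chi', character chi -> character chi' ->
     (forall b, B b -> chi b = chi' b) -> chi s = chi' s) -> B s.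
Proof.
move=> BP B1 sep; apply: contrapT => Bs.
have [B0 _ _ _ Bcl] := BP.
have [d d0 dB] := closed_nrm_dist Bcl Bs.
have A1 : (1 : A) <> 0.
  by move=> A1; apply: Bs; rewrite -[s]mulr1 A1 mulr0.
pose Q : set (A -> R) := [set q | forall b, B b -> d <= q (s - b)].
have Qinf C : C !=set0 -> C `<=` Q -> C `<=` algebra_seminorm ->
    Q (pointwise_inf C).
  by move=> C0 CQ CP b Bb; apply: le_pointwise_inf => // q /CQ; exact.
have [p [pP pd pmin]] :=
  minimal_seminorm (nrm_algebra_seminorm A_comm A1) (dB : Q nrm) Qinf.
pose F : set (A -> R[i]) :=
  [set chi | character chi /\ forall x, nrm (chi x) <= p x].
have selfadjE chi h : F chi -> star h = h -> chi h = (complex.Re (chi h))%:C.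
  case=> chiP _ hsa; have := char_selfadj A_comm chiP hsa.
  by case: (chi h) => a b /= ->.
have key h : B h -> star h = h -> forall chi chi', F chi -> F chi' ->
    complex.Re (chi h) <= complex.Re (chi' h).
  move=> Bh hsa chi0 chi1 Fchi0 Fchi1; rewrite leNgt; apply/negP => lt01.
  pose c := nrm h.
  have Reh chi : F chi -> - c <= complex.Re (chi h) <= c.
    case=> chiP _; rewrite -ler_norml (le_trans (nrm_ge_Re _))//.
    exact: char_le.
  have c0 : 0 <= c by exact: nrm_ge0.
  (* Both h + c and c - h have nonnegative values, so their norming characters attain the maximum
     and the minimum of h over [F]. *)
  have [chiM [chiMP chiMp hM]] := char_norming A_comm (h + c%:C *: (1 : A)) pP.
  have [chim [chimP chimp hm]] := char_norming A_comm (c%:C *: (1 : A) - h) pP.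
  have FM : F chiM by []. have Fm : F chim by [].
  have valM chi : F chi -> nrm (chi (h + c%:C *: (1 : A))) = complex.Re (chi h)
    + c.
    move=> Fchi; have hE := selfadjE _ _ Fchi hsa; have /andP[r1 r2] :=
      Reh _ Fchi.
    case: Fchi => chiP _; rewrite (charD chiP) char_scalar//
      hE -rmorphD nrmC /=.
    by rewrite ger0_norm//; lra.
  have valm chi : F chi -> nrm (chi (c%:C *: (1 : A) - h)) = c - complex.Re
    (chi h).
    move=> Fchi; have hE := selfadjE _ _ Fchi hsa; have /andP[r1 r2] :=
      Reh _ Fchi.
    case: Fchi => chiP _; rewrite charB// char_scalar// hE -rmorphB nrmC /=.
    by rewrite ger0_norm//; lra.
  pose a := complex.Re (chim h); pose b := complex.Re (chiM h).
  have rng chi : F chi -> a <= complex.Re (chi h) <= b.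
    move=> Fchi; have := proj2 Fchi (h + c%:C *: (1 : A)).
    have := proj2 Fchi (c%:C *: (1 : A) - h).
    rewrite valM// valm// -hM -hm valM// valm// -/a -/b; lra.
  have ab : a < b.
    by have /andP[? ?] := rng _ Fchi0; have /andP[? ?] := rng _ Fchi1; lra.
  have ba0 : 0 < b - a by rewrite subr_gt0.
  pose k : A := ((b - a)^-1)%:C *: (h - a%:C *: (1 : A)).
  have kval chi : F chi -> chi k = ((complex.Re (chi h) - a) / (b - a))%:C.
    move=> Fchi; have hE := selfadjE _ _ Fchi hsa; case: Fchi => chiP _.
    by rewrite (charZ chiP) charB// char_scalar// hE -rmorphB -rmorphM mulrC.
  have k01 chi : F chi -> 0 <= complex.Re (chi k) <= 1.
    move=> Fchi; rewrite kval//=; have /andP[? ?] := rng _ Fchi.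
    by apply/andP; split; [apply: divr_ge0; lra|rewrite ler_pdivrMr//; lra].
  have Bk : B k by apply: subalgZ => //; apply: subalgB => //; exact: subalgZ.
  have ksa : star k = k.
    rewrite /k starZ starB starZ star1 hsa.
    by rewrite !(_ : forall x : R, x%:C^* = x%:C)// => x; exact: conjc_real.
  have p1 (x : A) chi : F chi -> chi x = 1 ->
      (forall chi', F chi' -> nrm (chi' x) <= 1) -> p x = 1.
    move=> Fchi chix le1; apply/eqP; rewrite eq_le; apply/andP; split.
      by have [chi' [? ? <-]] := char_norming A_comm x pP; exact: le1.
    by rewrite -(@nrm1 R) -chix; case: Fchi.
  apply: (minimal_seminorm_selfadj BP B1 pP pd) Bk ksa _ _ _ => //.
  - by move=> chi chiP chip; exact: k01.
  - apply: (p1 _ chiM) => //; first by rewrite kval// divff ?gt_eqF.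
    move=> chi Fchi; have /andP[] := k01 _ Fchi.
    by rewrite kval// nrmC /= => ? ?; rewrite ger0_norm.
  - apply: (p1 _ chim) => //.
      by rewrite charB// (char1 chimP) kval// -/a subrr mul0r subr0.
    move=> chi Fchi; have /andP[] := k01 _ Fchi.
    case: (Fchi) => chiP _; rewrite charB// (char1 chiP) kval//.
    rewrite -(rmorph1 (real_complex R)) -rmorphB nrmC /= => ? ?.
    by rewrite ger0_norm; lra.
have eqF chi chi' : F chi -> F chi' -> forall b, B b -> chi b = chi' b.
  move=> Fchi Fchi' b Bb.
  have part h : B h -> star h = h -> chi h = chi' h.
    move=> Bh hsa; rewrite (selfadjE chi)// (selfadjE chi')//; congr (_%:C).
    by apply/eqP; rewrite eq_le !key.
  have Bsb : B (star b) by exact: subalg_star.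
  have := part (b + star b) (subalgD BP Bb Bsb).
  have := part ((0 +i* 1) *: (b - star b)) (subalgZ BP _ (subalgB BP Bb Bsb)).
  rewrite starD starK starZ starB starK.
  have -> : (0 +i* 1 : R[i])^* = - (0 +i* 1) by apply/eqP;
    rewrite eq_complex /= oppr0 !eqxx.
  rewrite scaleNr -scalerN opprB => /(_ erefl) e1 /(_ (addrC _ _)) e2.
  move: e1 e2; case: Fchi Fchi' => chiP _ [chiP' _].
  rewrite !(charZ chiP) !(charZ chiP') !(charD chiP) !(charD chiP') !charN//.
  move=> /mulfI; rewrite eq_complex /= oner_eq0 andbF => /(_ isT) e1 e2.
  have := congr2 +%R e1 e2; move: (chi b) (chi' b) (chi (star b)) (chi' (star
    b)) => u u' v v'.
  rewrite (_ : u - v + (u + v) = 2 * u); last by ring.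
  rewrite (_ : u' - v' + (u' + v') = 2 * u'); last by ring.
  by move=> /mulfI; apply; rewrite pnatr_eq0.
have [chi [chiP chip _]] := char_norming A_comm 1 pP.
have Bchi : B (chi s *: (1 : A)) by exact: subalgZ.
have := pd _ Bchi.
have [chi' [chiP' chip' <-]] := char_norming A_comm (s - chi s *: (1 : A)) pP.
rewrite charB// char_scalar// (sep chi chi')//; last exact: eqF.
by rewrite subrr nrm0 leNgt d0.
Qed.

End StoneWeierstrass.

(** * Generation *)

Section PhaseLemmas.
Context {R : realType}.

Definition bimonomial (m n : nat) (z : R[i]) : R[i] := z^* ^+ m * z ^+ n.

Lemma nrm_bimonomial m n (z : R[i]) : nrm (bimonomial m n z) = nrm z ^+ (m + n).
Proof. by rewrite nrmM !nrmX nrmJ exprD. Qed.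

Lemma bimonomial_nrm_eq m n (z z' : R[i]) : (0 < m + n)%N ->
  bimonomial m n z = bimonomial m n z' -> nrm z = nrm z'.
Proof.
move=> mn /(congr1 nrm); rewrite !nrm_bimonomial => /eqP.
by rewrite eqrXn2 ?nrm_ge0// => /eqP.
Qed.

(** The quotient has modulus 1, so conjugation inverts it and only the difference of the exponents
    survives. *)
Lemma bimonomial_phase m n (z z' : R[i]) : z' != 0 -> nrm z = nrm z' ->
  bimonomial m n z = bimonomial m n z' -> (z / z') ^+ `|m%:Z - n%:Z| = 1.
Proof.
move=> z'0 zz' e; set u := z / z'.
have z'n0 : nrm z' != 0 by apply: contra z'0 => /eqP/nrm_eq0 ->.
have uu : u * u^* = 1 by rewrite -sqr_nrm nrmM nrmV zz' divff// expr1n.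
have un : bimonomial m n u = 1.
  have bz0 : bimonomial m n z' != 0.
    by apply/eqP => /(congr1 nrm)/eqP; rewrite nrm0 nrm_bimonomial expf_eq0
      (negPf z'n0) andbF.
  apply: (mulIf bz0); rewrite mul1r -[RHS]e /bimonomial.
  by rewrite mulrACA -!exprMn -rmorphM divfK.
have [mn|/ltnW nm] := leqP m n.
  rewrite distnEr//; move: un; rewrite /bimonomial -{1}(subnKC mn) exprD mulrA.
  by rewrite -exprMn mulrC [_^* * _]mulrC uu expr1n mulr1.
rewrite distnEl//; move: un; rewrite /bimonomial -{1}(subnK nm) exprD -mulrA.
rewrite -exprMn [_^* * _]mulrC uu expr1n mulr1 => /(congr1 (fun w => w^*)).
by rewrite /= rmorphXn rmorph1 => <-; congr (_ ^+ _); rewrite -[LHS]conjcK.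
Qed.

(** The order of [u] is finite since [J] has a nonzero member, and it divides every member of
    [J]. *)
Lemma expr_order_dvd (u : R[i]) (J : set int) :
  is_gcd J 1 -> (forall m, J m -> u ^+ `|m| = 1) -> u = 1.
Proof.
move=> [[m0 Jm0 m00] _ _ gcd1] uJ.
have ex : exists d, (0 < d)%N && (u ^+ d == 1).
  by exists `|m0|%N; rewrite absz_gt0 m00 uJ// eqxx.
have [d /andP[d0 /eqP ud] dmin] := ex_minnP ex.
have : (d%:Z <= 1).
  apply: gcd1 => m Jm; rewrite dvdzE absz_nat /dvdn.
  have := uJ _ Jm; rewrite {1}(divn_eq `|m| d) exprD mulnC exprM ud expr1n
    mul1r => um.
  case: (posnP (`|m| %% d)%N) => [//|r0].
  have := dmin (`|m| %% d)%N; rewrite r0 um eqxx => /(_ isT).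
  by rewrite leqNgt ltn_pmod.
move: d0 ud; case: d {dmin} => [//|[|//]] _.
by rewrite expr1.
Qed.

Lemma expiD (a b : R) : expi (a + b) = expi a * expi b.
Proof.
by rewrite /expi cosD sinD; apply/eqP; rewrite eq_complex /= eqxx addrC eqxx.
Qed.

Lemma expiMn (a : R) n : expi (n%:R * a) = expi a ^+ n.
Proof.
elim: n => [|n IH]; first by rewrite mul0r /expi cos0 sin0 expr0.
by rewrite -natr1 mulrDl mul1r expiD IH exprSr.
Qed.

Lemma nrm_expi (a : R) : nrm (expi a) = 1.
Proof.
apply/eqP; rewrite -(@eqrXn2 _ 2) ?nrm_ge0// sqr_nrmE /= expr1n.
by rewrite cos2Dsin2.
Qed.

Lemma expi_eq1 (a : R) : `|a| < 2 * pi -> expi a = 1 -> a = 0.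
Proof.
move=> ha /eqP; rewrite eq_complex /= => /andP[/eqP ca _].
have s0 : sin (a / 2) = 0.
  apply/eqP; rewrite -sqrf_eq0; apply/eqP.
  have : cos (a / 2 + a / 2) = 1 by rewrite -splitr.
  rewrite cosD; have := cos2Dsin2 (a / 2); rewrite !expr2; lra.
apply/eqP; apply: contraT => a0.
have : sin (`|a| / 2) = 0.
  have [?|?] := leP 0 a; first by rewrite ger0_norm.
  by rewrite ltr0_norm// mulNr sinN s0 oppr0.
have h1 : 0 < `|a| / 2 by rewrite divr_gt0// normr_gt0.
have h2 : `|a| / 2 < pi by lra.
by have := @sin_gt0_pi _ (`|a| / 2); rewrite h1 h2 => /(_ isT) /[swap] ->;
  rewrite ltxx.
Qed.

(** Equal moduli give [eta = eta']. The n-th power erases the rotations, which are n-th roots of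
    unity, and is injective on a half-open arc of angle 2 pi / n, so [w = w']; disjointness of the
    [L] then identifies the sectors. *)
Lemma sector_phase_inj n (L : 'I_n -> set R[i]) (j k : 'I_n)
    (eta eta' : R) (w w' : R[i]) :
  (forall j, L j `<=` [set expi phi | phi in `[0, 2 * pi / n%:R[]) ->
  trivIset setT L -> 0 < eta -> 0 < eta' -> L j w -> L k w' ->
  let z := eta%:C * w * expi (2 * pi * j%:R / n%:R) in
  let z' := eta'%:C * w' * expi (2 * pi * k%:R / n%:R) in
  nrm z = nrm z' -> (z / z') ^+ n = 1 -> z = z'.
Proof.
move=> Larc Ldisj eta0 eta'0 Ljw Lkw' z z' zz' zn.
have n0 : n%:R != 0 :> R by rewrite pnatr_eq0 -lt0n (leq_trans _ (ltn_ord j)).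
have n_gt0 : 0 < n%:R :> R by rewrite lt_def n0 ler0n.
have [phi hphi we] := Larc _ _ Ljw; have [phi' hphi' we'] := Larc _ _ Lkw'.
have etaE : eta = eta'.
  move: zz'; rewrite /z /z' !nrmM !nrmC -we -we' !nrm_expi !mulr1.
  by rewrite !gtr0_norm.
have root1 (i : 'I_n) : expi (2 * pi * i%:R / n%:R) ^+ n = 1 :> R[i].
  rewrite -expiMn mulrCA divff// mulr1 [_ * i%:R]mulrC expiMn.
  by rewrite mulr_natl [X in X ^+ _](_ : _ = 1) ?expr1n// /expi cos2pi sin2pi.
have ww' : w = w'.
  have e' x : expi x != 0 :> R[i].
    by apply/eqP => /(congr1 nrm)/eqP; rewrite nrm_expi nrm0 oner_eq0.
  have : expi (n%:R * (phi - phi')) = 1.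
    apply: (mulIf (e' (n%:R * phi'))); rewrite -expiD -mulrDr subrK mul1r
      !expiMn.
    move: zn; rewrite expr_div_n !exprMn !root1 !mulr1 -etaE -mulf_div.
    rewrite divff ?expf_neq0 ?eqC_complex ?gt_eqF//; last first.
      by rewrite (_ : 0 = 0%:C :> R[i])// ltcR.
    rewrite mul1r -we -we' => /(congr1 (fun x => x * expi phi' ^+ n)).
    by rewrite divfK ?expf_neq0// mul1r.
  move=> /expi_eq1 e1; rewrite -we -we'; congr expi.
  apply/eqP; rewrite -subr_eq0 -(mulrI_eq0 _ (mulfI n0)) e1//.
  rewrite normrM ger0_norm ?ler0n// mulrC -ltr_pdivlMr//.
  move: hphi hphi'; rewrite /= !in_itv /= => /andP[? ?] /andP[? ?].
  by rewrite ltr_norml; apply/andP; split; lra.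
have jk : j = k.
  apply: contrapT => /eqP jk; have /trivIsetP/(_ j k I I jk) := Ldisj.
  by move=> /seteqP[/(_ w)]; case; split=> //; rewrite ww'.
by rewrite /z /z' etaE ww' jk.
Qed.
End PhaseLemmas.

Section Generation.
Context {R : realType} {A : cstarAlgType R}.
Hypothesis A_comm : commutative (fun x y : A => x * y).
#[local] HB.instance Definition _ :=
  GRing.PzRing_hasCommutativeMul.Build (CstarAlgebra.sort A) A_comm.

Lemma cstar_gen_subalgebra (G : set A) : cstar_subalgebra (cstar_gen G).
Proof.
split.
- by move=> B [[]].
- by move=> a x y xG yG B BG; case: (BG) => -[_ h _ _ _] _; apply: h;
  [exact: xG|exact: yG].
- by move=> x y xG yG B BG; case: (BG) => -[_ _ h _ _] _; apply: h;
  [exact: xG|exact: yG].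
- by move=> x xG B BG; case: (BG) => -[_ _ _ h _] _; apply: h; exact: xG.
- by apply: closed_bigI => B [[]].
Qed.

Lemma cstar_gen1 (G : set A) : cstar_gen G 1.
Proof. by move=> B [_]; apply; right. Qed.

Lemma sub_cstar_gen (G : set A) : G `<=` cstar_gen G.
Proof. by move=> x Gx B [_]; apply; left. Qed.

Lemma cstar_gen_min (G B : set A) : cstar_subalgebra B -> B 1 -> G `<=` B ->
  cstar_gen G `<=` B.
Proof. by move=> BP B1 GB x; apply; split=> // y [/GB//|->]. Qed.

Lemma char_bimonomial chi (t : A) m n : character chi ->
  chi (star t ^+ m * t ^+ n) = bimonomial m n (chi t).
Proof. by move=> chiP; rewrite (charM chiP) !charX// char_star. Qed.

Lemma cstar_gen_bimonomials (t : A) (Xi : set (nat * nat)) :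
  cstar_gen [set t] = setT ->
  (forall chi chi', character chi -> character chi' ->
     (forall mn, Xi mn -> bimonomial mn.1 mn.2 (chi t) =
                          bimonomial mn.1 mn.2 (chi' t)) ->
     chi t = chi' t) ->
  cstar_gen [set star t ^+ mn.1 * t ^+ mn.2 | mn in Xi] = setT.
Proof.
move=> t_gen sep; set G := [set _ | _ in Xi].
have Gt : cstar_gen G t.
  apply: stone_weierstrass => //; [exact: cstar_gen_subalgebra|exact:
    cstar_gen1|].
  move=> chi chi' chiP chiP' e; apply: sep => // mn Xmn.
  by rewrite -!char_bimonomial// e//; apply: sub_cstar_gen; exists mn.
apply/seteqP; split=> // x _.
have : cstar_gen [set t] x by rewrite t_gen.
apply: cstar_gen_min; [exact: cstar_gen_subalgebra|exact: cstar_gen1|].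
by move=> _ ->.
Qed.
End Generation.

(** * Completely positive maps *)

Section SquareRoot.
Context {R : realType} {A : cstarAlgType R}.
Hypothesis A_comm : commutative (fun x y : A => x * y).
#[local] HB.instance Definition _ :=
  GRing.PzRing_hasCommutativeMul.Build (CstarAlgebra.sort A) A_comm.

Lemma geometric_limit (u : nat -> A) (q c : R) : 0 <= q -> q < 1 -> 0 <= c ->
  (forall n, nrm (u n.+1 - u n) <= c * q ^+ n) ->
  exists l, forall e : R, 0 < e ->
    exists N, forall n, (N <= n)%N -> nrm (u n - l) < e.
Proof.
move=> q0 q1 c0 hu; have q1' : 0 < 1 - q by rewrite subr_gt0.
have far n k : nrm (u (n + k)%N - u n) <= q ^+ n * (c / (1 - q)).
  elim: k n => [|k IH] n.
    by rewrite addn0 subrr nrm0 !mulr_ge0 ?exprn_ge0 ?invr_ge0 ?(ltW q1').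
  rewrite addnS -addSn (_ : _ - _ = (u (n.+1 + k)%N - u n.+1) + (u n.+1 - u
    n)); last by rewrite addrA subrK.
  apply: le_trans (ler_nrmD _ _) _; apply: le_trans (lerD (IH _) (hu _)) _.
  rewrite le_eqVlt; apply/orP; left; apply/eqP; rewrite exprS; field.
  by rewrite gt_eqF.
have tail (e : R) : 0 < e -> exists N, forall n, (N <= n)%N ->
  nrm (u n - u N) < e.
  move=> e0; have [N hN] := exp_vanish (c / (1 - q)) q0 q1 e0.
  by exists N => n /subnKC <-; apply: le_lt_trans (far _ _) hN.
have : cvg (u @ \oo).
  apply/cauchy_cvgP/cauchy_exP => e e0.
  have eE : e = (complex.Re e)%:C by rewrite RRe_real// realE ltW.
  have [|N hN] := tail (complex.Re e); first by move: e0; rewrite {1}eE ltcR.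
  exists (u N); exists N => // n /= Nn; rewrite -ball_normE /=.
  by rewrite distrC nrmE eE ltcR hN.
move=> /cvg_ex[l /cvgrPdist_lt ul]; exists l => e e0.
have [|N _ hN] := ul e%:C; first by rewrite ltcR.
exists N => n Nn; have := hN n Nn; rewrite /= nrmE ltcR.
by rewrite nrm_distC.
Qed.

Lemma nrm_zero_lim (x : A) : (forall e : R, 0 < e -> nrm x <= e) -> x = 0.
Proof.
move=> h; apply: nrm_eq0; apply/eqP; rewrite eq_le nrm_ge0 andbT.
by apply/ler_addgt0Pr => e /h; rewrite add0r.
Qed.

(* The iteration [y := (x + y * y) / 2] converges to [1 - sqrt (1 - x)]. *)
Lemma sqrt_one_minus (x : A) : nrm x < 1 -> star x = x ->
  exists2 s, star s = s & s * s = 1 - x.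
Proof.
move=> x1 xsa; pose h : R[i] := (2^-1 : R)%:C.
have hE : nrm h = 2^-1 by rewrite nrmC ger0_norm.
have hh : h + h = 1 by rewrite -rmorphD -[RHS](rmorph1 (real_complex R));
  congr (_%:C); lra.
pose y := fix y n : A := if n is n'.+1 then h *: (x + y n' * y n') else 0.
(* This [r] bounds the iterates, since (||x|| + r^2) / 2 <= r when r < 1, and it is the contraction
   ratio, since half the sum of two iterates has norm at most r. *)
pose r := (1 + nrm x) / 2.
have nx0 := nrm_ge0 x.
have r0 : 0 <= r by rewrite /r; lra. have r1 : r < 1 by rewrite /r; lra.
have yr n : nrm (y n) <= r.
  elim: n => [|n IH]; first by rewrite nrm0.
  rewrite /= nrmZ hE.
  have := ler_nrmD x (y n * y n); have := nrmMA (y n) (y n).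
  have := ler_pM (nrm_ge0 _) (nrm_ge0 _) IH IH.
  have : r * r <= 1 by rewrite mulr_ile1// ltW.
  by rewrite /r; lra.
have ysa n : star (y n) = y n.
  elim: n => [|n IH]; first by rewrite star0.
  by rewrite /= starZ starD starMA IH xsa (_ : h^* = h)//; exact: conjc_real.
have step n : nrm (y n.+2 - y n.+1) <= r * nrm (y n.+1 - y n).
  rewrite [y n.+2]/= [X in _ - X]/= -scalerBr nrmZ hE.
  rewrite (_ : _ - _ = (y n.+1 - y n) * (y n.+1 + y n)); last by ring.
  have yyr : nrm (y n.+1 + y n) <= r + r.
    by apply: le_trans (ler_nrmD _ _) _; rewrite lerD.
  have := nrmMA (y n.+1 - y n) (y n.+1 + y n).
  have := ler_wpM2l (nrm_ge0 (y n.+1 - y n)) yyr; lra.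
have geo n : nrm (y n.+1 - y n) <= nrm (y 1%N) * r ^+ n.
  elim: n => [|n IH]; first by rewrite subr0 expr0 mulr1.
  by rewrite (le_trans (step _))// exprS mulrCA ler_wpM2l.
have [l hl] := geometric_limit r0 r1 (nrm_ge0 _) geo.
have lsa : star l = l.
  apply/eqP; rewrite -subr_eq0; apply/eqP/nrm_zero_lim => e e0.
  have e20 : 0 < e / 2 by rewrite divr_gt0.
  have [N /(_ N (leqnn _)) hN] := hl _ e20.
  rewrite (_ : _ - _ = (y N - l) - star (y N - l)); last by rewrite starB ysa;
    ring.
  have := ler_nrmB (y N - l) (star (y N - l)); rewrite nrm_star; lra.
have lr : nrm l <= r.
  apply/ler_addgt0Pr => e /hl[N /(_ N (leqnn _)) hN].
  have := ler_nrmB (y N) (y N - l); rewrite opprB addrC subrK.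
  by have := yr N; lra.
have lE : l = h *: (x + l * l).
  apply/eqP; rewrite -subr_eq0; apply/eqP/nrm_zero_lim => e e0.
  have e20 : 0 < e / 2 by rewrite divr_gt0.
  have [N hN] := hl _ e20; have h1 := hN N.+1 (leqnSn _); have h0 :=
    hN N (leqnn _).
  rewrite (_ : _ - _ = h *: ((y N - l) * (y N + l)) - (y N.+1 - l)); last first.
    rewrite [y N.+1]/= (_ : (_ - _) * _ = (x + y N * y N) - (x + l * l));
      last by ring.
    rewrite scalerBr; ring.
  apply: le_trans (ler_nrmB _ _) _; rewrite nrmZ hE.
  have ylr : nrm (y N + l) <= 2.
    apply: le_trans (ler_nrmD _ _) _; have := yr N; lra.
  have := nrmMA (y N - l) (y N + l).
  have := ler_wpM2l (nrm_ge0 (y N - l)) ylr; lra.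
exists (1 - l); first by rewrite starB star1 lsa.
have -> : (1 - l) * (1 - l) = 1 + l * l - (l + l) by ring.
by rewrite {3 4}lE -scalerDl hh scale1r; ring.
Qed.

(** The shift by [e] puts 1 - (y + e) / c strictly inside the unit ball, where the iteration for the
    square root converges geometrically. *)
Lemma char_ge0_sqrt (y : A) (e : R) : star y = y ->
  (forall chi, character chi -> 0 <= complex.Re (chi y)) -> 0 < e ->
  exists2 s, star s = s & s * s = y + e%:C *: (1 : A).
Proof.
move=> ysa y0 e0; pose c := nrm y + e; have ny0 := nrm_ge0 y.
have c0 : 0 < c by rewrite /c; lra.
pose x : A := 1 - (c^-1)%:C *: (y + e%:C *: (1 : A)).
have conjR (a : R) : (a%:C)^* = a%:C by exact: conjc_real.
have xsa : star x = x by rewrite /x starB star1 starZ starD starZ star1 ysa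
  !conjR.
have x1 : nrm x < 1.
  have ec : e / c <= 1 by rewrite ler_pdivrMr// mul1r /c; lra.
  apply: (@le_lt_trans _ _ (1 - e / c)); last by rewrite gtrBl divr_gt0.
  apply: (nrm_char_le A_comm); first by rewrite subr_ge0.
  move=> chi chiP; have := y0 _ chiP; have := char_le chiP y.
  rewrite charB// (char1 chiP) (charZ chiP) (charD chiP) char_scalar//.
  have := char_selfadj A_comm chiP ysa; have := nrm_ge_Re (chi y).
  case: (chi y) => a b /= + b0; rewrite b0 => ha hn a0.
  rewrite -[a +i* 0]/(a%:C) -(rmorph1 (real_complex R)) -rmorphD -rmorphM
    -rmorphB nrmC.
  have : a <= nrm y by rewrite (le_trans (ler_norm a))// (le_trans ha).
  move=> an; have ea : c^-1 * (a + e) <= 1 by rewrite ler_pdivrMl//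
    mulr1 lerD2r.
  have : e / c <= c^-1 * (a + e) by rewrite [e / c]mulrC ler_pM2l ?invr_gt0//
    lerDr.
  by rewrite ger0_norm; lra.
have [s ssa sE] := sqrt_one_minus x1 xsa.
exists ((Num.sqrt c)%:C *: s); first by rewrite starZ ssa conjR.
rewrite -scalerAlA -scalerArA scalerA -rmorphM -expr2 sqr_sqrtr ?ltW//.
by rewrite sE /x opprB addrC subrK scalerA -rmorphM divff ?gt_eqF// scale1r.
Qed.
End SquareRoot.

(** * Real inner products and operator bounds *)

Section RealInner.
Context {R : realType} {H : hilbertType R}.
Implicit Types u v w : H.

(** A symmetric real bilinear form with the same norm, to which discriminants and linear arithmetic
    apply. *)
Definition rin v w : R := complex.Re (inner v w).

Lemma inner_lin (a : R[i]) u v w :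
  inner (a *: u + v) w = a * inner u w + inner v w.
Proof. exact: (inner_linear w a u v). Qed.

Lemma innerDl u v w : inner (u + v) w = inner u w + inner v w.
Proof. by rewrite -[u]scale1r inner_lin mul1r scale1r. Qed.

Lemma inner0l w : inner 0 w = 0 :> R[i].
Proof. by apply: (addrI (inner 0 w)); rewrite -innerDl !addr0. Qed.

Lemma innerZl (a : R[i]) u w : inner (a *: u) w = a * inner u w.
Proof. by rewrite -[_ *: _]addr0 inner_lin inner0l addr0. Qed.

Lemma innerDr u v w : inner w (u + v) = inner w u + inner w v.
Proof.
by rewrite [LHS]inner_conj innerDl rmorphD [inner w u]inner_conj [inner w
  v]inner_conj.
Qed.

Lemma inner0r w : inner w 0 = 0 :> R[i].
Proof. by rewrite inner_conj inner0l rmorph0. Qed.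

Lemma rinC v w : rin v w = rin w v.
Proof. by rewrite /rin inner_conj; case: inner. Qed.

Lemma rinDl u v w : rin (u + v) w = rin u w + rin v w.
Proof. by rewrite /rin innerDl raddfD. Qed.

Lemma rinDr u v w : rin w (u + v) = rin w u + rin w v.
Proof. by rewrite !(rinC w) rinDl. Qed.

Lemma rinZl (c : R) v w : rin (c%:C *: v) w = c * rin v w.
Proof. by rewrite /rin innerZl; case: inner => a b /=; rewrite mul0r subr0. Qed.

Lemma rinZr (c : R) v w : rin v (c%:C *: w) = c * rin v w.
Proof. by rewrite !(rinC v) rinZl. Qed.

Lemma rinNl v w : rin (- v) w = - rin v w.
Proof. by rewrite -scaleN1r -(rmorphN1 (real_complex R)) rinZl mulN1r. Qed.

Lemma rinNr v w : rin v (- w) = - rin v w.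
Proof. by rewrite !(rinC v) rinNl. Qed.

Lemma rinBl u v w : rin (u - v) w = rin u w - rin v w.
Proof. by rewrite rinDl rinNl. Qed.

Lemma rinBr u v w : rin w (u - v) = rin w u - rin w v.
Proof. by rewrite rinDr rinNr. Qed.

Lemma rin0l v : rin 0 v = 0. Proof. by rewrite /rin inner0l. Qed.
Lemma rin0r v : rin v 0 = 0. Proof. by rewrite rinC rin0l. Qed.

Lemma rin_sqr v : rin v v = nrm v ^+ 2.
Proof. by rewrite /rin inner_norm nrmE -rmorphXn. Qed.

Lemma discriminant_le (a b c : R) : 0 <= c ->
  (forall s, 0 <= a + 2 * b * s + c * s ^+ 2) -> b ^+ 2 <= a * c.
Proof.
move=> c0 h; have [c00|cn0] := eqVneq c 0.
  have [->|bn0] := eqVneq b 0; first by rewrite c00 mulr0 expr0n.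
  (* At this point the affine function would take the value -1. *)
  have := h (- (a + 1) / (2 * b)); rewrite c00 mul0r addr0 mulrC divfK
    ?mulf_neq0//.
  by lra.
have c_gt0 : 0 < c by rewrite lt_def cn0.
have := mulr_ge0 (h (- b / c)) c0.
have -> : (a + 2 * b * (- b / c) + c * (- b / c) ^+ 2) * c = a * c - b ^+ 2 by
  field.
by rewrite subr_ge0.
Qed.

Lemma rin_CS v w : rin v w ^+ 2 <= nrm v ^+ 2 * nrm w ^+ 2.
Proof.
apply: discriminant_le; first exact: sqr_ge0.
move=> s; have := sqr_ge0 (nrm (v + s%:C *: w)).
rewrite -!rin_sqr !(rinDl, rinDr) !rinZr !rinZl (rinC w v); lra.
Qed.

Lemma rin_le v w : `|rin v w| <= nrm v * nrm w.
Proof.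
rewrite -(@ler_pXn2r _ 2) ?nnegrE ?mulr_ge0 ?nrm_ge0//.
by rewrite real_normK ?num_real// exprMn rin_CS.
Qed.

Lemma nrm_dual v c : 0 <= c -> (forall w, rin v w <= c * nrm w) -> nrm v <= c.
Proof.
move=> c0 /(_ v); rewrite rin_sqr expr2 => h.
have [->|v0] := eqVneq (nrm v) 0; first exact: c0.
by rewrite -(ler_pM2r (_ : 0 < nrm v)) ?lt_def ?v0 ?nrm_ge0.
Qed.

Section Bop.
Implicit Types S T : bop H.

Lemma bopDE S T v : (S + T) v = S v + T v. Proof. by []. Qed.
Lemma bopBE S T v : (S - T) v = S v - T v. Proof. by []. Qed.
Lemma bopZE (c : R[i]) T v : (c *: T) v = c *: T v. Proof. by []. Qed.
Lemma bopME S T v : (S * T) v = S (T v). Proof. by []. Qed.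
Lemma bop1E v : (1 : bop H) v = v. Proof. by []. Qed.

Lemma bopD T v w : T (v + w) = T v + T w.
Proof. by have := bop_linear T 1 v w; rewrite !scale1r. Qed.

Lemma bop0 T : T 0 = 0.
Proof. by apply: (addrI (T 0)); rewrite -bopD !addr0. Qed.

Lemma bopZ T (c : R[i]) v : T (c *: v) = c *: T v.
Proof. by have := bop_linear T c v 0; rewrite bop0 !addr0. Qed.

Lemma bopN T v : T (- v) = - T v.
Proof. by rewrite -scaleN1r bopZ scaleN1r. Qed.

Lemma bopB T v w : T (v - w) = T v - T w.
Proof. by rewrite bopD bopN. Qed.

Lemma bop_bound T : exists2 M : R, 0 <= M & forall v, nrm (T v) <= M * nrm v.
Proof.
have [M M0 TM] := bounded_op_ge0 (bop_bounded T).
have ME : M = (complex.Re M)%:C by rewrite RRe_real// ger0_real.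
exists (complex.Re M); first by move: M0; rewrite {1}ME lecR.
by move=> v; rewrite -lecR rmorphM /= -ME -!nrmE.
Qed.

Lemma opnorm_le T c : (forall v, nrm (T v) <= c * nrm v) -> 0 <= c ->
  opnorm T <= c.
Proof.
move=> Tc c0; apply: ge_sup.
  by exists (nrm (T 0)); exists 0 => //=; rewrite normr0.
move=> _ [v /= v1 <-]; apply: le_trans (Tc v) _; rewrite ler_piMr//.
by rewrite -lecR -nrmE.
Qed.

Lemma le_opnorm T v : nrm (T v) <= opnorm T * nrm v.
Proof.
have [M M0 TM] := bop_bound T.
have unit w : nrm w <= 1 -> nrm (T w) <= opnorm T.
  move=> w1; apply: ub_le_sup; last by exists w => //=;
    rewrite nrmE -[1](rmorph1 (real_complex R)) lecR.
  exists M => _ [u /= u1 <-]; apply: le_trans (TM u) _; rewrite ler_piMr//.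
  by rewrite -lecR -nrmE.
have [v0|v0] := eqVneq (nrm v) 0.
  by rewrite (nrm_eq0 v0) bop0 !nrm0 mulr0.
have v_gt0 : 0 < nrm v by rewrite lt_def v0 nrm_ge0.
have cE : nrm ((nrm v)^-1%:C : R[i]) = (nrm v)^-1.
  by rewrite nrmC ger0_norm// invr_ge0 nrm_ge0.
have := unit ((nrm v)^-1%:C *: v); rewrite bopZ !nrmZ cE mulVf//
  lexx => /(_ isT).
by rewrite ler_pdivrMl// mulrC.
Qed.
End Bop.
End RealInner.

(** * Inequalities for completely positive maps *)

Section CompletelyPositive.
Context {R : realType} {A : cstarAlgType R} {H : hilbertType R}.
Hypothesis A_comm : commutative (fun x y : A => x * y).
#[local] HB.instance Definition _ :=
  GRing.PzRing_hasCommutativeMul.Build (CstarAlgebra.sort A) A_comm.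

(** Complete positivity is tested on Gram matrices of elements of [A] only. A representation maps
    these to positive operator matrices, so no order on matrices over [A] has to be developed. *)
Record cp_map (Psi : A -> bop H) : Prop := CpMap {
  cp_linear : linear Psi ;
  cp1 : Psi 1 = 1 ;
  cp_pos : forall n (y : 'I_n -> A) (v : 'I_n -> H),
    0 <= \sum_i \sum_j inner (Psi (star (y i) * y j) (v j)) (v i) }.

Lemma inner_suml n (v : 'I_n -> H) w :
  inner (\sum_i v i) w = \sum_i inner (v i) w.
Proof.
by elim/big_ind2: _ => [|x x' y y' <- <-|//]; rewrite ?inner0l ?innerDl.
Qed.

Lemma inner_sumr n (v : 'I_n -> H) w :
  inner w (\sum_i v i) = \sum_i inner w (v i).
Proof.
by elim/big_ind2: _ => [|x x' y y' <- <-|//]; rewrite ?inner0r ?innerDr.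
Qed.

Lemma representation_cp (f : A -> bop H) : representation f -> cp_map f.
Proof.
move=> [lin mul one adj]; split=> // n y v.
have -> : \sum_i \sum_j inner (f (star (y i) * y j) (v j)) (v i) =
    inner (\sum_j f (y j) (v j)) (\sum_i f (y i) (v i)).
  rewrite inner_sumr; apply: eq_bigr => i _; rewrite inner_suml.
  by apply: eq_bigr => j _; rewrite mul bopME adj starK.
by rewrite inner_norm exprn_ge0.
Qed.

Lemma ucp_cp (f : A -> bop H) (Phi : bop H -> bop H) :
  representation f -> ucp Phi -> cp_map (Phi \o f).
Proof.
move=> fP [[lin pos] one]; have [flin _ f1 _] := fP; split => /=.
- by move=> a x y /=; rewrite flin lin.
- by rewrite f1 one.
- move=> n y v; pose T := \matrix_(i, j) f (star (y i) * y j).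
  have Tpos : mx_positive T.
    move=> w; rewrite (eq_bigr (fun i => \sum_j
      inner (f (star (y i) * y j) (w j)) (w i))).
      exact: (cp_pos (representation_cp fP)).
    by move=> i _; apply: eq_bigr => j _; rewrite mxE.
  rewrite (eq_bigr (fun i => \sum_j inner (map_mx Phi T i j (v j)) (v i))).
    exact: pos.
  by move=> i _; apply: eq_bigr => j _; rewrite !mxE.
Qed.

Section OneMap.
Variable Psi : A -> bop H.
Hypothesis PsiP : cp_map Psi.

Lemma cpD x y v : Psi (x + y) v = Psi x v + Psi y v.
Proof. by have := cp_linear PsiP 1 x y; rewrite !scale1r => ->. Qed.

Lemma cp0 v : Psi 0 v = 0.
Proof. by apply: (addrI (Psi 0 v)); rewrite -cpD !addr0. Qed.

Lemma cpZ c x v : Psi (c *: x) v = c *: Psi x v.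
Proof.
have := cp_linear PsiP c x 0; rewrite addr0 => ->.
by rewrite bopDE cp0 addr0.
Qed.

Lemma cpN x v : Psi (- x) v = - Psi x v.
Proof. by rewrite -scaleN1r cpZ scaleN1r. Qed.

Lemma cpB x y v : Psi (x - y) v = Psi x v - Psi y v.
Proof. by rewrite cpD cpN. Qed.

Lemma cp1E v : Psi 1 v = v.
Proof. by rewrite (cp1 PsiP). Qed.

(* The 2 x 2 positivity condition forces a real quadratic form. *)
Lemma cp_adj y v w : inner (Psi y v) w = inner v (Psi (star y) w).
Proof.
have im1 x u : complex.Im (inner (Psi (star x * x) u) u) = 0.
  have := cp_pos PsiP (fun=> x : A) (fun _ : 'I_1 => u).
  by rewrite !big_ord_recl !big_ord0 !addr0 => /ger0_Im.
have im2 u w' : complex.Im (inner (Psi y u) w' + inner (Psi (star y) w') u) = 0.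
  have := cp_pos PsiP (fun i : 'I_2 => nth 0 [:: 1; y] i)
    (fun i : 'I_2 => nth 0 [:: w'; u] i).
  rewrite !big_ord_recl !big_ord0 !addr0 /= => /ger0_Im.
  rewrite star1 !mul1r mulr1 !raddfD /= im1 -{1}[1]mulr1 -{1}star1 im1.
  by rewrite add0r addr0.
have := im2 v w; have := im2 ((0 +i* 1) *: v) w.
rewrite bopZ [inner v _]inner_conj [inner _ (_ *: v)]inner_conj !innerZl.
rewrite [inner v _]inner_conj.
move: (inner (Psi y v) w) (inner (Psi (star y) w) v) => [a b] [c d] /=.
rewrite !raddfD /= => e1 e2; apply/eqP; rewrite eq_complex /=; lra.
Qed.

Lemma cp_radj y v w : rin (Psi y v) w = rin v (Psi (star y) w).
Proof. by rewrite /rin cp_adj. Qed.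

(** Size 3 is what Cauchy-Schwarz between a sum of two formal vectors and a third one needs; zeros
    give the smaller sizes. *)
Lemma cp_form3 y1 y2 y3 v1 v2 v3 :
  0 <= rin (Psi (star y1 * y1) v1) v1 + rin (Psi (star y2 * y2) v2) v2 +
       rin (Psi (star y3 * y3) v3) v3 + 2 * rin (Psi (star y1 * y2) v2) v1 +
       2 * rin (Psi (star y1 * y3) v3) v1 + 2 * rin (Psi (star y2 * y3) v3) v2.
Proof.
have := cp_pos PsiP (fun i : 'I_3 => nth 0 [:: y1; y2; y3] i)
  (fun i : 'I_3 => nth 0 [:: v1; v2; v3] i).
rewrite !big_ord_recl !big_ord0 !addr0 /= lecE => /andP[_].
rewrite !raddfD /= -!/(rin _ _).
rewrite (cp_radj (star y2 * y1)) (cp_radj (star y3 * y1)) (cp_radj (star y3 *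
  y2)).
rewrite !starMA !starK !(rinC _ (Psi _ _)); lra.
Qed.

Lemma cp_sqr_ge0 y v : 0 <= rin (Psi (star y * y) v) v.
Proof.
have := cp_form3 y 0 0 v 0 0.
by rewrite !(mulr0, cp0) !(rin0l, rin0r, mulr0, addr0).
Qed.

(* Cauchy-Schwarz in the semi-inner product space spanned by the formal
   vectors y (x) v with <y (x) v, z (x) w> = <Psi (z^* y) v, w>. *)
Lemma cp_CS y1 y2 z v1 v2 w :
  rin (Psi (star z * y1) v1 + Psi (star z * y2) v2) w ^+ 2 <=
  (rin (Psi (star y1 * y1) v1) v1 + rin (Psi (star y2 * y2) v2) v2 +
     2 * rin (Psi (star y1 * y2) v2) v1) *
  rin (Psi (star z * z) w) w.
Proof.
apply: discriminant_le; first exact: cp_sqr_ge0.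
move=> s; have := cp_form3 y1 y2 z v1 v2 (s%:C *: w).
rewrite !bopZ !rinZl !rinZr rinDl (cp_radj (star z * y1)) (cp_radj (star z *
  y2)).
rewrite !starMA !starK !(rinC _ (Psi _ _)); lra.
Qed.

(** Positivity is available on squares, and y + e is one; the extra term is harmless because [Psi]
    is unital. *)
Lemma cp_ge0 y v : star y = y ->
  (forall chi, character chi -> 0 <= complex.Re (chi y)) ->
    0 <= rin (Psi y v) v.
Proof.
move=> ysa y0; apply/ler_addgt0Pr => e e0.
have n0 : 0 < nrm v ^+ 2 + 1 by rewrite ltr_wpDl ?sqr_ge0.
have [s ssa sE] := char_ge0_sqrt A_comm ysa y0 (divr_gt0 e0 n0).
have := cp_sqr_ge0 s v; rewrite ssa sE cpD cpZ cp1E.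
rewrite rinDl rinZl rin_sqr => /le_trans; apply; rewrite lerD2l.
by rewrite mulrAC ler_pdivrMr// ler_pM2l// lerDl.
Qed.

Lemma cp_mono x y v : star x = x -> star y = y ->
  (forall chi, character chi -> complex.Re (chi x) <= complex.Re (chi y)) ->
  rin (Psi x v) v <= rin (Psi y v) v.
Proof.
move=> xsa ysa le; rewrite -subr_ge0 -rinBl -cpB; apply: cp_ge0.
  by rewrite starB xsa ysa.
by move=> chi chiP; rewrite charB// raddfB subr_ge0 le.
Qed.

Lemma cp_sqr_le y v : rin (Psi (star y * y) v) v <= nrm y ^+ 2 * nrm v ^+ 2.
Proof.
have := @cp_mono (star y * y) ((nrm y ^+ 2)%:C *: (1 : A)) v.
rewrite starMA starK cpZ rinZl cp1E rin_sqr; apply=> //.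
  by rewrite starZ star1; congr (_ *: _); exact: conjc_real.
move=> chi chiP; rewrite char_scalar//= (charM chiP) char_star//
  mulrC -sqr_nrm /=.
by rewrite lerXn2r ?nnegrE ?nrm_ge0// char_le.
Qed.

(** The Kadison-Schwarz inequality: Cauchy-Schwarz between y (x) v and 1 (x) Psi y v. *)
Lemma cp_schwarz y v : nrm (Psi y v) ^+ 2 <= rin (Psi (star y * y) v) v.
Proof.
have := cp_CS y 0 1 v 0 (Psi y v).
rewrite star1 !mul1r !mulr0 !cp0 !rin0l cp1E rin_sqr mulr0 !addr0.
rewrite rin_sqr; have [->|n0] := eqVneq (nrm (Psi y v)) 0.
  by move=> _; rewrite expr0n; exact: cp_sqr_ge0.
by rewrite expr2 ler_pM2r// exprn_gt0// lt_def n0 nrm_ge0.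
Qed.

Lemma cp_norm y v : nrm (Psi y v) <= nrm y * nrm v.
Proof.
rewrite -(@ler_pXn2r _ 2) ?nnegrE ?mulr_ge0 ?nrm_ge0// exprMn.
exact: le_trans (cp_schwarz y v) (cp_sqr_le y v).
Qed.
End OneMap.
End CompletelyPositive.

(** * Asymptotic multiplicative domain and moments *)

Section Asymptotics.
Context {R : realType} {H : hilbertType R}.
Implicit Types (T S g : nat -> H -> H) (q : nat -> H -> R).

(** Convergence to 0 in operator norm, stated for plain functions so that composites need not be
    packaged as operators. *)
Definition null_seq T := forall e : R, 0 < e ->
  \forall n \near \oo, forall v, nrm (T n v) <= e * nrm v.

(** One-sided: an asymptotic upper bound by 0. Lower bounds are stated for the opposite form. *)
Definition small_form q := forall e : R, 0 < e ->
  \forall n \near \oo, forall v, q n v <= e * nrm v ^+ 2.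

Definition bounded_by (c : R) g := forall n v, nrm (g n v) <= c * nrm v.

Lemma null_le c T S : (forall n v, nrm (T n v) <= c * nrm (S n v)) ->
  null_seq S -> null_seq T.
Proof.
move=> TS S0 e e0; have c0 : 0 < `|c| + 1 by rewrite ltr_wpDl.
apply: filterS (S0 _ (divr_gt0 e0 c0)) => n Sn v.
have cc : c <= `|c| + 1 by rewrite (le_trans (ler_norm _))// lerDl.
apply: le_trans (TS n v) _; apply: le_trans (ler_wpM2r (nrm_ge0 _) cc) _.
apply: le_trans (ler_wpM2l (ltW c0) (Sn v)) _.
by rewrite mulrA mulrCA divff ?gt_eqF// mulr1.
Qed.

Lemma null_ext T S : (forall n v, T n v = S n v) -> null_seq S -> null_seq T.
Proof. by move=> e; apply: (null_le (c := 1)) => n v; rewrite mul1r e. Qed.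

Lemma nullD T S : null_seq T -> null_seq S ->
  null_seq (fun n v => T n v + S n v).
Proof.
move=> T0 S0 e e0; have e20 : 0 < e / 2 by rewrite divr_gt0.
apply: filterS2 (T0 _ e20) (S0 _ e20) => n Tn Sn v.
apply: le_trans (ler_nrmD _ _) _; have := Tn v; have := Sn v; lra.
Qed.

Lemma null_comp c T g : bounded_by c g -> null_seq T ->
  null_seq (fun n v => T n (g n v)).
Proof.
move=> gc T0 e e0; have c0 : 0 < `|c| + 1 by rewrite ltr_wpDl.
apply: filterS (T0 _ (divr_gt0 e0 c0)) => n Tn v.
apply: le_trans (Tn _) _; rewrite mulrAC ler_pdivrMr// -mulrA ler_pM2l//.
apply: le_trans (gc n v) _; rewrite mulrC ler_wpM2l ?nrm_ge0//.
by rewrite (le_trans (ler_norm _))// lerDl.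
Qed.

Lemma smallD q q' : small_form q -> small_form q' ->
  small_form (fun n v => q n v + q' n v).
Proof.
move=> q0 q0' e e0; have e20 : 0 < e / 2 by rewrite divr_gt0.
by apply: filterS2 (q0 _ e20) (q0' _ e20) => n h h' v; have := h v; have :=
  h' v; lra.
Qed.

Lemma small_le q q' : (forall n v, q n v <= q' n v) -> small_form q' ->
  small_form q.
Proof.
by move=> qq q0 e /q0; apply: filterS => n h v; apply: le_trans (qq n v) (h v).
Qed.

Lemma small_comp c q g : bounded_by c g -> small_form q ->
  small_form (fun n v => q n (g n v)).
Proof.
move=> gc q0 e e0; have c0 : 0 < `|c| + 1 by rewrite ltr_wpDl.
apply: filterS (q0 _ (divr_gt0 e0 (exprn_gt0 2 c0))) => n qn v.
apply: le_trans (qn _) _; rewrite mulrAC ler_pdivrMr ?exprn_gt0//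
  -mulrA ler_pM2l//.
rewrite mulrC -exprMn lerXn2r ?nnegrE ?nrm_ge0 ?mulr_ge0 ?nrm_ge0 ?(ltW c0)//.
apply: le_trans (gc n v) _; rewrite ler_wpM2r ?nrm_ge0//.
by rewrite (le_trans (ler_norm _))// lerDl.
Qed.

Lemma null_small c T g : bounded_by c g -> null_seq T ->
  small_form (fun n v => rin (T n v) (g n v)).
Proof.
move=> gc T0 e e0; have c0 : 0 < `|c| + 1 by rewrite ltr_wpDl.
apply: filterS (T0 _ (divr_gt0 e0 c0)) => n Tn v.
rewrite (le_trans (ler_norm _))// (le_trans (rin_le _ _))//.
apply: le_trans (ler_pM (nrm_ge0 _) (nrm_ge0 _) (Tn v) (gc n v)) _.
have cc : c <= `|c| + 1 by rewrite (le_trans (ler_norm _))// lerDl.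
have cn : `|c| + 1 != 0 by rewrite gt_eqF.
rewrite [X in X <= _](_ : _ = (e * nrm v ^+ 2) * (c / (`|c| + 1)));
  last by field.
rewrite ler_piMr ?mulr_ge0 ?nrm_ge0 ?(ltW e0)// ler_pdivrMr// mul1r.
exact: cc.
Qed.

Lemma small_sqr_null T : small_form (fun n v => nrm (T n v) ^+ 2) -> null_seq T.
Proof.
move=> T0 e e0; apply: filterS (T0 _ (exprn_gt0 2 e0)) => n h v.
by rewrite -(@ler_pXn2r _ 2) ?nnegrE ?mulr_ge0 ?nrm_ge0 ?(ltW e0)// exprMn.
Qed.

Definition symmetric_op (g : H -> H) := forall v w, rin (g v) w = rin v (g w).

Lemma null_adj T S : (forall n v w, rin (T n v) w = rin v (S n w)) ->
  null_seq S -> null_seq T.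
Proof.
move=> adj S0 e e0; apply: filterS (S0 _ e0) => n Sn v.
apply: nrm_dual; first by rewrite mulr_ge0 ?nrm_ge0 ?ltW.
move=> w; rewrite adj (le_trans (ler_norm _))// (le_trans (rin_le _ _))//.
by apply: le_trans (ler_wpM2l (nrm_ge0 v) (Sn w)) _; rewrite mulrCA mulrA.
Qed.

(** Cauchy-Schwarz for the form of [P], between [v] and [P v]. *)
Lemma psd_bound (P : bop H) (M : R) : symmetric_op P -> 0 <= M ->
  (forall v, nrm (P v) <= M * nrm v) -> (forall v, 0 <= rin (P v) v) ->
  forall v, nrm (P v) ^+ 2 <= M * rin (P v) v.
Proof.
move=> Psym M0 PM P0 v; have CS : rin (P v) (P v) ^+ 2 <=
    rin (P v) v * rin (P (P v)) (P v).
  apply: discriminant_le => // s.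
  have := P0 (v + s%:C *: P v); rewrite bopD bopZ !(rinDl, rinDr) !rinZl !rinZr.
  by rewrite (Psym (P v) v); lra.
have [Pv0|Pv0] := eqVneq (nrm (P v)) 0; first by rewrite Pv0 expr0n mulr_ge0.
have Pv_gt0 : 0 < nrm (P v) ^+ 2 by rewrite exprn_gt0// lt_def Pv0 nrm_ge0.
rewrite rin_sqr in CS; rewrite -(ler_pM2r Pv_gt0) -expr2; apply: le_trans CS _.
rewrite [M * _]mulrC -mulrA ler_wpM2l//.
apply: le_trans (ler_norm _) _; apply: le_trans (rin_le _ _) _.
by rewrite expr2 mulrA ler_wpM2r ?nrm_ge0.
Qed.

(* Test the hypothesis on approximate eigenvectors at the bottom of [X]. *)
Lemma lyapunov_ge0 (X B : bop H) (d : R) : symmetric_op X -> symmetric_op B ->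
  0 < d -> (forall v, d * nrm v ^+ 2 <= rin (B v) v) ->
  (forall v, 0 <= rin (X (B v)) v) -> forall v, 0 <= rin (X v) v.
Proof.
move=> Xsym Bsym d0 Bd XB v0; rewrite leNgt; apply/negP => Xv0.
have [M M0 XM] := bop_bound X; have [N N0 BN] := bop_bound B.
pose S := [set rin (X v) v | v in [set v : H | nrm v = 1]].
have scale (v : H) : nrm v != 0 -> exists u : H,
  nrm u = 1 /\ v = (nrm v)%:C *: u.
  move=> vn0; exists ((nrm v)^-1%:C *: v).
  rewrite nrmZ nrmC ger0_norm ?invr_ge0 ?nrm_ge0// mulVf//; split=> //.
  by rewrite scalerA -rmorphM divff// scale1r.
have v0n : nrm v0 != 0.
  by apply: contraTneq Xv0 => /nrm_eq0 ->; rewrite bop0 rin0l ltxx.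
have [u0 [u01 u0E]] := scale _ v0n.
have S_inf : has_inf S.
  split; first by exists (rin (X u0) u0); exists u0.
  exists (- M) => _ [v /= v1 <-]; rewrite lerNl (le_trans (ler_norm _))//
    normrN.
  by have := rin_le (X v) v; have := XM v; rewrite v1 !mulr1; lra.
pose m := - inf S.
have m0 : 0 < m.
  rewrite oppr_gt0; have le : inf S <= rin (X u0) u0 by apply: ge_inf;
    [case: S_inf|exists u0].
  apply: le_lt_trans le _; move: Xv0; rewrite {1 2}u0E bopZ rinZl rinZr mulrA.
  by rewrite pmulr_rlt0// mulr_gt0// lt_def v0n nrm_ge0.
pose P : bop H := X + m%:C *: (1 : bop H).
have PE v : P v = X v + m%:C *: v by [].
have Psym : symmetric_op P.
  by move=> v w; rewrite !PE rinDl rinDr Xsym rinZl rinZr.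
have PM v : nrm (P v) <= (M + m) * nrm v.
  rewrite PE mulrDl (le_trans (ler_nrmD _ _))// nrmZ nrmC ger0_norm ?(ltW m0)//.
  by rewrite lerD2r.
have P0 v : 0 <= rin (P v) v.
  have [vn0|vn0] := eqVneq (nrm v) 0.
    by rewrite (nrm_eq0 vn0) bop0 rin0l.
  have [u [u1 ->]] := scale _ vn0; rewrite bopZ rinZl rinZr mulrA.
  rewrite mulr_ge0 ?mulr_ge0 ?nrm_ge0// PE rinDl rinZl rin_sqr u1 expr1n mulr1.
  by rewrite -lerBlDr sub0r opprK; apply: ge_inf; [case: S_inf|exists u].
have Mm0 : 0 <= M + m by rewrite addr_ge0// ltW.
(* With this [e], N^2 (M + m) e is at most half of (m d)^2, against m d <= N ||P v|| for a unit
   vector v whose value is within e of the infimum. *)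
pose e := (m * d) ^+ 2 / (2 * (N ^+ 2 * (M + m) + 1)).
have D0 : 0 < 2 * (N ^+ 2 * (M + m) + 1).
  by rewrite mulr_gt0// ltr_wpDl// mulr_ge0// sqr_ge0.
have e0 : 0 < e by rewrite divr_gt0// exprn_gt0// mulr_gt0.
have [_ [v /= v1 <-] hv] := inf_adherent e0 S_inf.
have Pv : nrm (P v) ^+ 2 <= (M + m) * e.
  apply: le_trans (psd_bound Psym Mm0 PM P0 v) _; rewrite ler_wpM2l//.
  by rewrite PE rinDl rinZl rin_sqr v1 /m; lra.
have md : m * d <= N * nrm (P v).
  have := XB v; have -> : rin (X (B v)) v = rin (B v) (P v) - m * rin (B v) v.
    by rewrite Xsym PE rinDr rinZr; ring.
  have := Bd v; rewrite v1 expr1n mulr1 => Bv.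
  have := rin_le (B v) (P v); have := BN v; rewrite v1 mulr1 => BNv.
  have := ler_wpM2r (nrm_ge0 (P v)) BNv; have := ler_wpM2l (ltW m0) Bv.
  have := ler_norm (rin (B v) (P v)); lra.
have : (m * d) ^+ 2 <= N ^+ 2 * ((M + m) * e).
  apply: le_trans (ler_wpM2l (sqr_ge0 N) Pv); rewrite -exprMn.
  by rewrite lerXn2r ?nnegrE ?mulr_ge0 ?nrm_ge0 ?(ltW m0) ?(ltW d0).
have eE : e * (2 * (N ^+ 2 * (M + m) + 1)) = (m * d) ^+ 2 by rewrite divfK
  ?gt_eqF.
have := mulr_ge0 (mulr_ge0 (sqr_ge0 N) Mm0) (ltW e0).
move: eE; lra.
Qed.

(** [X] is nonnegative only up to a small d; for P = X + d, the bound of ||P g||^2 by a multiple of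
    <P g, g> turns smallness of the form on the range of [g] into smallness of X g. *)
Lemma null_of_form (X : nat -> bop H) g (M c : R) : 0 <= M ->
  (forall n, symmetric_op (X n)) -> bounded_by M (fun n v => X n v) ->
  bounded_by c g -> small_form (fun n v => - rin (X n v) v) ->
  small_form (fun n v => rin (X n (g n v)) (g n v)) ->
    null_seq (fun n v => X n (g n v)).
Proof.
move=> M0 Xsym XM gc Xlow Xg; apply: small_sqr_null => e e0.
pose K := 4 * (M + 1) * (1 + c ^+ 2).
have c2 := sqr_ge0 c.
have K0 : 0 < K by rewrite !mulr_gt0//; lra.
pose d := Num.min 1 (e / K).
have d0 : 0 < d by rewrite lt_min ltr01 divr_gt0.
have d1 : d <= 1 by rewrite ge_min lexx.
have Kd : K * d <= e by rewrite mulrC -ler_pdivlMr// ge_min lexx orbT.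
apply: filterS2 (Xlow _ d0) (Xg _ d0) => n low upp v.
pose P : bop H := X n + d%:C *: (1 : bop H).
have PE w : P w = X n w + d%:C *: w by [].
have dE : nrm (d%:C : R[i]) = d by rewrite nrmC gtr0_norm.
have Psym : symmetric_op P.
  by move=> u w; rewrite !PE rinDl rinDr Xsym rinZl rinZr.
have PM w : nrm (P w) <= (M + 1) * nrm w.
  rewrite PE (le_trans (ler_nrmD _ _))// nrmZ dE mulrDl lerD ?XM//.
  by rewrite ler_wpM2r ?nrm_ge0.
have P0 w : 0 <= rin (P w) w.
  by rewrite PE rinDl rinZl rin_sqr; have := low w; lra.
have M10 : 0 <= M + 1 by lra.
have Pg := psd_bound Psym M10 PM P0 (g n v).
have gv : nrm (g n v) ^+ 2 <= c ^+ 2 * nrm v ^+ 2.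
  rewrite -exprMn lerXn2r ?nnegrE ?nrm_ge0 ?gc//.
  exact: le_trans (nrm_ge0 _) (gc n v).
have Pgg : rin (P (g n v)) (g n v) <= (1 + c ^+ 2) * d * nrm v ^+ 2.
  rewrite PE rinDl rinZl rin_sqr; have := upp v.
  have := ler_wpM2l (ltW d0) gv; lra.
have Xle : nrm (X n (g n v)) ^+ 2 <=
    2 * nrm (P (g n v)) ^+ 2 + 2 * (d ^+ 2 * nrm (g n v) ^+ 2).
  have := ler_nrmB (P (g n v)) (d%:C *: g n v);
    rewrite PE addrK nrmZ dE -/(P _).
  have := nrm_ge0 (X n (g n v)); rewrite -exprMn.
  move: (nrm _) (nrm (P _)) (d * _) => x y z x0 xyz.
  have : x ^+ 2 <= (y + z) ^+ 2.
    by rewrite lerXn2r ?nnegrE// (le_trans x0).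
  have := sqr_ge0 (y - z); rewrite !sqrrD; lra.
have v2 := sqr_ge0 (nrm v).
have h1 := ler_wpM2l M10 Pgg.
have d2 : d ^+ 2 <= d by rewrite expr2 ler_piMl// ltW.
have h2 : d ^+ 2 * nrm (g n v) ^+ 2 <= d * (c ^+ 2 * nrm v ^+ 2).
  by rewrite ler_pM ?sqr_ge0.
have h3 : d * (c ^+ 2 * nrm v ^+ 2) <= (M + 1) * ((1 + c ^+ 2) * d * nrm v ^+
  2).
  have h4 : 0 <= M * (d * ((1 + c ^+ 2) * nrm v ^+ 2)).
    by apply: mulr_ge0 => //; apply: mulr_ge0 (ltW d0) (mulr_ge0 _ v2);
      rewrite addr_ge0.
  have := mulr_ge0 (ltW d0) v2.
  move: h4; lra.
have := ler_wpM2r v2 Kd; rewrite /K; lra.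
Qed.

(** Passing to adjoints, ||y X v||^2 = <y y X v, X v>, and y y X is the adjoint of X y y. *)
Lemma null_halve (X : nat -> bop H) (y : bop H) (M : R) : 0 <= M ->
  (forall n, symmetric_op (X n)) -> bounded_by M (fun n v => X n v) ->
  symmetric_op y -> null_seq (fun n v => X n (y (y v))) ->
    null_seq (fun n v => X n (y v)).
Proof.
move=> M0 Xsym XM ysym Xyy.
apply: (@null_adj _ (fun n v => y (X n v))) => [n v w|].
  by rewrite Xsym ysym.
apply: small_sqr_null; apply: (@small_le _ (fun n v => rin (y (y (X n v))) (X n
  v))).
  by move=> n v; rewrite -rin_sqr ysym rinC.
apply: null_small XM _; apply: null_adj Xyy => n v w.
by rewrite ysym ysym Xsym.
Qed.
End Asymptotics.

(** * The asymptotic multiplicative domain *)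

Section MultiplicativeDomain.
Context {R : realType} {A : cstarAlgType R} {H : hilbertType R}.
Hypothesis A_comm : commutative (fun x y : A => x * y).
#[local] HB.instance Definition _ :=
  GRing.PzRing_hasCommutativeMul.Build (CstarAlgebra.sort A) A_comm.
Variables (f : A -> bop H) (Psi : nat -> A -> bop H).
Hypotheses (fP : representation f) (PsiP : forall n, cp_map (Psi n)).

Lemma repM x y v : f (x * y) v = f x (f y v).
Proof. by case: fP => _ mul _ _; rewrite mul. Qed.

Lemma rep_bounded y : bounded_by (nrm y) (fun _ v => f y v).
Proof. by move=> _ v; apply: cp_norm => //; exact: representation_cp. Qed.

(** With [f y] instead of [Psi n y] on the right, the case [z = 1] says that [y] is asymptotically
    fixed. *)
Definition asym_mult (y : A) :=
  forall z, null_seq (fun n v => Psi n (z * y) v - Psi n z (f y v)).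

Definition asym_fixed (y : A) := null_seq (fun n v => Psi n y v - f y v).

Lemma asym_mult_weak y : asym_mult y -> asym_fixed y.
Proof.
by move=> /(_ 1); apply: null_ext => n v; rewrite mul1r cp1E.
Qed.

Lemma asym_mult1 : asym_mult 1.
Proof.
move=> z e e0; apply: nearW => n v; case: fP => _ _ -> _.
by rewrite mulr1 bop1E subrr nrm0 mulr_ge0 ?nrm_ge0 ?ltW.
Qed.

Lemma asym_mult_lin c x y : asym_mult x -> asym_mult y ->
  asym_mult (c *: x + y).
Proof.
move=> hx hy z; have fcp := representation_cp fP.
pose T n v := c *: (Psi n (z * x) v - Psi n z (f x v)).
apply: (@null_ext _ _ _ (fun n v => T n v + (Psi n (z * y) v - Psi n z (f y
  v)))).
  move=> n v; rewrite /T (cpD fcp) (cpZ fcp) bopD bopZ mulrDr -scalerArA.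
  by rewrite cpD// cpZ// scalerBr opprD addrACA.
apply: nullD (hy z); apply: null_le (hx z) => n v.
by rewrite nrmZ.
Qed.

Lemma asym_multM x y : asym_mult x -> asym_mult y -> asym_mult (x * y).
Proof.
move=> hx hy z.
apply: (@null_ext _ _ _ (fun n v => (Psi n (z * x * y) v - Psi n (z * x) (f y
  v)) +
    (Psi n (z * x) (f y v) - Psi n z (f x (f y v))))).
  by move=> n v; rewrite mulrA repM addrA subrK.
by apply: nullD; [exact: hy|apply: (null_comp (rep_bounded y) (hx z))].
Qed.

Lemma asym_mult_closed (y : A) : (forall e : R, 0 < e -> exists2 x,
  asym_mult x & nrm (y - x) < e) ->
  asym_mult y.
Proof.
move=> approx z e e0; have z0 : 0 < 2 * nrm z + 1 by have := nrm_ge0 z; lra.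
have [|x hx yx] := approx (e / 2 / (2 * nrm z + 1)); first by rewrite !divr_gt0.
have e20 : 0 < e / 2 by rewrite divr_gt0.
apply: filterS (hx z _ e20) => n hn v; have fcp := representation_cp fP.
rewrite (_ : _ - _ = (Psi n (z * x) v - Psi n z (f x v)) +
   (Psi n (z * (y - x)) v - Psi n z (f (y - x) v))); last first.
  rewrite mulrBr (cpB (PsiP n)) (cpB fcp) bopB.
  by rewrite opprB [RHS]addrACA [X in _ = X + _]addrC subrK addKr.
apply: le_trans (ler_nrmD _ _) _.
have h1 := cp_norm A_comm (PsiP n) (z * (y - x)) v.
have h2 := cp_norm A_comm (PsiP n) z (f (y - x) v).
have h3 := cp_norm A_comm fcp (y - x) v.
have h4 := ler_nrmB (Psi n (z * (y - x)) v) (Psi n z (f (y - x) v)).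
have h5 := ler_wpM2r (nrm_ge0 v) (nrmMA z (y - x)).
have h6 := ler_wpM2l (nrm_ge0 z) h3.
have h7 : 2 * (nrm z * nrm (y - x)) <= e / 2.
  move: yx; rewrite ltr_pdivlMr// => yx; have := nrm_ge0 (y - x).
  move: yx; lra.
have h8 := ler_wpM2r (nrm_ge0 v) h7; have := hn v.
move: h1 h2 h3 h4 h5 h6 h8; rewrite !mulrA; lra.
Qed.

(** The form is the squared seminorm of the formal vector k y (x) v - k (x) f y v; Cauchy-Schwarz
    against [star z] gives the conclusion for every z. *)
Lemma asym_mult_form k y :
  small_form (fun n v => rin (Psi n (star k * k * (star y * y)) v) v
    - 2 * rin (Psi n (star k * k * y) v) (f y v)
    + rin (Psi n (star k * k) (f y v)) (f y v)) ->
  forall z, null_seq (fun n v => Psi n (z * (k * y)) v - Psi n (z * k) (f y v)).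
Proof.
move=> form z; apply: small_sqr_null => e e0.
have z0 : 0 < nrm z ^+ 2 + 1 by have := sqr_ge0 (nrm z); lra.
apply: filterS (form _ (divr_gt0 e0 z0)) => n hn v.
set w := Psi n (z * (k * y)) v - Psi n (z * k) (f y v).
have := cp_CS (PsiP n) (k * y) k (star z) v (- f y v) w.
rewrite starK !bopN -/w rin_sqr.
rewrite starMA (_ : star y * star k * (k * y) = star k * k * (star y * y));
  last by ring.
rewrite (_ : star y * star k * k = star (star k * k * y)); last first.
  by rewrite !starMA starK; ring.
rewrite !rinNl rinNr opprK (rinC (Psi n (star _) _)) -(cp_radj (PsiP n)).
set Q := (X in X * _); have -> : Q = rin (Psi n (star k * k * (star y * y)) v) v
    - 2 * rin (Psi n (star k * k * y) v) (f y v)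
    + rin (Psi n (star k * k) (f y v)) (f y v) by rewrite /Q; ring.
have Q0 := hn v; move: (_ + _) Q0 => {}Q Q0 h.
have h2 := cp_sqr_le A_comm (PsiP n) (star z) w; rewrite nrm_star starK in h2.
have [w0|w0] := eqVneq (nrm w) 0.
  by rewrite w0 expr0n mulr_ge0 ?sqr_ge0 ?ltW.
have w_gt0 : 0 < nrm w ^+ 2 by rewrite exprn_gt0// lt_def w0 nrm_ge0.
rewrite -(ler_pM2r w_gt0) -expr2; apply: le_trans h _.
have h0 := cp_sqr_ge0 (PsiP n) (star z) w; rewrite starK in h0.
apply: le_trans (ler_wpM2r h0 Q0) _.
have ez0 : 0 <= e / (nrm z ^+ 2 + 1) * nrm v ^+ 2.
  by rewrite mulr_ge0 ?sqr_ge0// divr_ge0 ?ltW.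
apply: le_trans (ler_wpM2l ez0 h2) _.
rewrite mulrA ler_wpM2r ?sqr_ge0//.
rewrite mulrAC ler_wpM2r ?sqr_ge0// mulrAC ler_pdivrMr// ler_pM2l//.
by rewrite lerDl.
Qed.

Lemma asym_fixed_star y : asym_fixed y -> asym_fixed (star y).
Proof.
apply: null_adj => n v w; have fcp := representation_cp fP.
by rewrite rinBl rinBr (cp_radj (PsiP n)) (cp_radj fcp) starK.
Qed.

Lemma asym_mult_of_weak y : asym_fixed y -> asym_fixed (star y * y) ->
  asym_mult y.
Proof.
move=> hy hyy z; have fcp := representation_cp fP.
have : null_seq (fun n v => Psi n (z * (1 * y)) v - Psi n (z * 1) (f y v)).
  apply: asym_mult_form; rewrite star1.
  apply: (@small_le _ _ _ (fun n v => rin (Psi n (star y * y) v - f (star y *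
    y) v) v
      + rin (Psi n y v - f y v) ((- 2)%:C *: f y v))).
    move=> n v; rewrite !mul1r cp1E// rinZr !rinBl.
    have -> : rin (f (star y * y) v) v = rin (f y v) (f y v).
      by rewrite repM (cp_radj fcp) starK.
    lra.
  apply: smallD; first by apply: (@null_small _ _ 1) hyy => n v; rewrite mul1r.
  apply: (@null_small _ _ (2 * nrm y)) hy => n v.
  by rewrite nrmZ nrmC normrN ger0_norm// -mulrA ler_wpM2l// rep_bounded.
by apply: null_ext => n v; rewrite mul1r mulr1.
Qed.

(** [asym_mult] concerns factors on the right; taking adjoints moves them to the left. *)
Definition mult_domain : set A := [set y | asym_mult y /\ asym_mult (star y)].

Lemma mult_domain_subalgebra : cstar_subalgebra mult_domain.
Proof.
have asym_mult0 : asym_mult 0.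
  by have := asym_mult_lin (-1) asym_mult1 asym_mult1; rewrite scaleN1r addNr.
split.
- by split; rewrite ?star0.
- move=> a x y [x1 x2] [y1 y2]; split; first exact: asym_mult_lin.
  by rewrite starD starZ; exact: asym_mult_lin.
- move=> x y [x1 x2] [y1 y2]; split; first exact: asym_multM.
  by rewrite starMA; exact: asym_multM.
- by move=> x [x1 x2]; split=> //; rewrite starK.
- move=> y cly.
  have approx (e : R) : 0 < e -> exists2 x, mult_domain x & nrm (y - x) < e.
    move=> e0; have [|x [Mx yx]] := cly (ball y e%:C).
      by apply: nbhsx_ballx; rewrite ltcR.
    by exists x => //; move: yx; rewrite -ball_normE /= nrmE ltcR.
  split; apply: asym_mult_closed => e /approx[x [x1 x2] yx]; first by exists x.
  by exists (star x) => //; rewrite -starB nrm_star.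
Qed.

Lemma mult_domain1 : mult_domain 1.
Proof. by split; rewrite ?star1; exact: asym_mult1. Qed.

Lemma mult_domain_of_weak y : asym_fixed y -> asym_fixed (star y * y) ->
  mult_domain y.
Proof.
move=> hy hyy; split; first exact: asym_mult_of_weak.
by apply: asym_mult_of_weak; [exact: asym_fixed_star|rewrite starK mulrC].
Qed.
End MultiplicativeDomain.

(** * Moments of [star t * t] under one map *)

Section Moments.
Context {R : realType} {A : cstarAlgType R} {H : hilbertType R}.
Hypothesis A_comm : commutative (fun x y : A => x * y).
#[local] HB.instance Definition _ :=
  GRing.PzRing_hasCommutativeMul.Build (CstarAlgebra.sort A) A_comm.
Variables (t : A).

Let b : A := star t * t.

Lemma sqmodX i : b ^+ i = star (t ^+ i) * t ^+ i.
Proof. by rewrite exprMn starX. Qed.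

Lemma sqmod_sa i : star (b ^+ i) = b ^+ i.
Proof. by rewrite starX starMA starK. Qed.

Lemma sqmod1_sa : star b = b.
Proof. by rewrite starMA starK. Qed.

Lemma char_sqmod chi i : character chi ->
  chi (b ^+ i) = ((nrm (chi t) ^+ 2) ^+ i)%:C.
Proof.
move=> chiP; rewrite charX// (charM chiP) char_star// mulrC -sqr_nrm.
by rewrite -rmorphXn.
Qed.

Lemma char_sqmod_shift chi (d : R) i : character chi ->
  chi ((b + d%:C *: (1 : A)) ^+ i) = ((nrm (chi t) ^+ 2 + d) ^+ i)%:C.
Proof.
move=> chiP; rewrite charX// (charD chiP) char_scalar// -[b]expr1 char_sqmod//.
by rewrite expr1 -rmorphD -rmorphXn.
Qed.

Lemma sqmod_shift_sa (d : R) i :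
  star ((b + d%:C *: (1 : A)) ^+ i) = (b + d%:C *: (1 : A)) ^+ i.
Proof.
rewrite starX starD -[b]expr1 sqmod_sa starZ star1.
by have -> : (d%:C)^* = d%:C by exact: conjc_real.
Qed.

Section OneMoment.
Variables (f Psi : A -> bop H).
Hypotheses (fP : representation f) (PsiP : cp_map Psi).

Let fcp : cp_map f := representation_cp fP.

Lemma sqmod_moment_ge0 i v : 0 <= rin (Psi (b ^+ i) v) v.
Proof. by rewrite sqmodX cp_sqr_ge0. Qed.

Lemma sqmod_sym i : symmetric_op (Psi (b ^+ i)).
Proof. by move=> v w; rewrite (cp_radj PsiP) sqmod_sa. Qed.

(** Gram positivity for [t ^+ i] and [t ^+ i * b]. The vectors stay independent so that [u] can be
    [f D v]. *)
Lemma moment_log_convex i u v :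
  2 * rin (Psi (b ^+ i.+1) u) v <=
  rin (Psi (b ^+ i) u) u + rin (Psi (b ^+ i.+2) v) v.
Proof.
have := cp_form3 PsiP (t ^+ i) (t ^+ i * b) 0 u (- v) 0.
rewrite !(bopN, mulr0, cp0 PsiP) !(rinNl, rinNr, rin0l, rin0r, mulr0,
  addr0) opprK.
rewrite (starMA _ b) sqmod1_sa -!sqmodX.
rewrite (_ : b * star (t ^+ i) * (t ^+ i * b) = b ^+ i.+2); last first.
  by rewrite !exprS [b ^+ i]sqmodX; ring.
rewrite (_ : star (t ^+ i) * (t ^+ i * b) = b ^+ i.+1); last first.
  by rewrite mulrA -sqmodX exprSr.
by rewrite (sqmod_sym i.+1 u v) (rinC u); lra.
Qed.

Variables (d C : R) (r : nat).
Hypotheses (d0 : 0 < d) (C1 : 1 <= C).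

Let D : A := b + d%:C *: (1 : A).
Let g (j : nat) : R := j%:R * (r%:R - j%:R).

Lemma sqmod_shift_lower i v :
  d ^+ i * nrm v ^+ 2 <= rin (f (D ^+ i) v) v.
Proof.
have := @cp_mono _ _ _ A_comm _ fcp ((d ^+ i)%:C *: (1 : A)) (D ^+ i) v.
rewrite (cpZ fcp) rinZl (cp1E fcp) rin_sqr; apply.
- by rewrite starZ star1; congr (_ *: _); exact: conjc_real.
- exact: sqmod_shift_sa.
- move=> chi chiP; rewrite char_scalar// char_sqmod_shift//=.
  by apply: lerXn2r; rewrite ?nnegrE ?lerDr ?sqr_ge0 ?addr_ge0 ?sqr_ge0 ?(ltW
    d0).
Qed.

(* Averaging the bounds for the two neighbours of [j] gains 1 on the concave
   barrier [g j = j * (r - j) <= r ^+ 2]. *)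
Lemma moment_barrier_step k : 0 <= k -> (0 < r)%N ->
  (forall j v, (j <= r)%N ->
     rin (Psi (b ^+ j) v) v <= (C + k * g j) * rin (f (D ^+ j) v) v) ->
  (forall v, rin (Psi (b ^+ r) v) v <= C * rin (f (D ^+ r) v) v) ->
  forall j v, (j <= r)%N ->
    rin (Psi (b ^+ j) v) v <=
      (C + k * (1 - (r%:R ^+ 2)^-1) * g j) * rin (f (D ^+ j) v) v.
Proof.
move=> k0 r0 hk hr [|j] v jr.
  rewrite /g !mul0r mulr0 addr0 !expr0 (cp1E PsiP) (cp1E fcp).
  by rewrite ler_peMl// rin_sqr sqr_ge0.
move: jr; rewrite leq_eqVlt => /predU1P[->|jr].
  by rewrite /g subrr !mulr0 addr0.
pose c := C + k * (g j.+1 - 1).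
have gE : g j + g j.+2 = 2 * g j.+1 - 2.
  by rewrite /g -!natr1; ring.
have g_le : g j.+1 <= r%:R ^+ 2.
  have jr' : j.+1%:R <= r%:R :> R by rewrite ler_nat ltnW.
  rewrite /g expr2; have : 0 <= j.+1%:R :> R by []. 
  move: (j.+1%:R) (r%:R) jr' => x y xy x0; nra.
have rr : 0 < r%:R ^+ 2 :> R by rewrite exprn_gt0// ltr0n.
apply: (@le_trans _ _ (c * rin (f (D ^+ j.+1) v) v)); last first.
  rewrite ler_wpM2r//.
    by apply: le_trans (sqmod_shift_lower _ _); rewrite mulr_ge0 ?sqr_ge0//
      exprn_ge0// ltW.
  rewrite /c lerD2l -mulrA ler_wpM2l// mulrBl mul1r lerD2l lerN2.
  by rewrite ler_pdivrMl// mulr1.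
rewrite -subr_ge0 -rinZl -rinBl.
pose X : bop H := c%:C *: f (D ^+ j.+1) - Psi (b ^+ j.+1).
have symD i : symmetric_op (f (D ^+ i)).
  by move=> u w; rewrite (cp_radj fcp) sqmod_shift_sa.
have symX : symmetric_op X.
  move=> u w; rewrite /X !bopBE !bopZE !rinBl !rinBr rinZl rinZr.
  by rewrite (symD _ u) (sqmod_sym _ u).
(* Log-convexity at the vectors [f D u] and [u] makes the form of X (f D) nonnegative; the factor
   [f D], bounded below by [d], is then removed. *)
apply: (lyapunov_ge0 symX (symD 1%N) d0) => [u|u].
  by have := sqmod_shift_lower 1 u; rewrite !expr1.
rewrite /X !bopBE !bopZE rinBl rinZl -repM// -exprSr.
have := moment_log_convex j (f (D ^+ 1) u) u.
have h1 := hk j (f (D ^+ 1) u) (ltnW (ltnW jr)).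
have h2 := hk j.+2 u jr.
rewrite -repM// (_ : D ^+ j * D ^+ 1 = D ^+ j.+1) ?expr1 -?exprSr// in h1 *.
rewrite -[f D u]/(f D u) (_ : rin (f (D ^+ j.+1) u) (f D u) = rin (f (D ^+
  j.+2) u) u) in h1; last first.
  by rewrite -{2}[D]expr1 -(symD 1%N) expr1 -repM// exprS.
have cE : (C + k * g j) + (C + k * g j.+2) = 2 * c.
  by rewrite /c addrACA -mulrDr gE; ring.
move: h1 h2; set W := rin (f (D ^+ j.+2) u) u => h1 h2 h3.
have : 2 * rin (Psi (b ^+ j.+1) (f D u)) u <= 2 * (c * W).
  apply: le_trans h3 _; rewrite [2 * (c * W)]mulrA -cE mulrDl; lra.
lra.
Qed.

(** Norm bounds together with [D >= d] give the estimate with some slack [k0 * g j]; every barrier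
    step multiplies the slack by 1 - 1 / r^2. At 0 and r the barrier vanishes, and there the
    estimate holds without slack. *)
Lemma moment_le :
  (forall v, rin (Psi (b ^+ r) v) v <= C * rin (f (D ^+ r) v) v) ->
  forall j v, (j <= r)%N -> rin (Psi (b ^+ j) v) v <= C * rin (f (D ^+ j) v) v.
Proof.
move=> hr j v jr; have [r0|r0] := posnP r.
  by move: jr hr; rewrite r0 leqn0 => /eqP ->; exact.
pose K j := nrm (b ^+ j) / d ^+ j.
have K0 i : 0 <= K i by rewrite divr_ge0 ?nrm_ge0// exprn_ge0// ltW.
pose k0 := \sum_(i < r) K i.
have k00 : 0 <= k0 by apply: sumr_ge0.
pose q : R := 1 - (r%:R ^+ 2)^-1.
have r1 : 1 <= r%:R ^+ 2 :> R by rewrite exprn_ege1// ler1n.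
have q0 : 0 <= q by rewrite subr_ge0 invf_le1// (lt_le_trans ltr01).
have q1 : q < 1 by rewrite gtrBl invr_gt0 (lt_le_trans ltr01).
have Dge0 i u : 0 <= rin (f (D ^+ i) u) u.
  by apply: le_trans (sqmod_shift_lower _ _); rewrite mulr_ge0 ?sqr_ge0//
    exprn_ge0// ltW.
have iter n : forall i u, (i <= r)%N ->
    rin (Psi (b ^+ i) u) u <= (C + k0 * q ^+ n * g i) * rin (f (D ^+ i) u) u.
  elim: n => [|n IH] i u ir.
    rewrite expr0 mulr1; case: i ir => [_|i].
      rewrite /g !mul0r mulr0 addr0 !expr0 (cp1E PsiP) (cp1E fcp).
      by rewrite ler_peMl// rin_sqr sqr_ge0.
    rewrite leq_eqVlt => /predU1P[->|ir];
      first by rewrite /g subrr !mulr0 addr0.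
    apply: (@le_trans _ _ (K i.+1 * rin (f (D ^+ i.+1) u) u)).
      apply: le_trans (ler_norm _) _; apply: le_trans (rin_le _ _) _.
      apply: le_trans (ler_wpM2r (nrm_ge0 _) (cp_norm A_comm PsiP _ _)) _.
      apply: le_trans (ler_wpM2l (K0 _) (sqmod_shift_lower _ _)).
      by rewrite /K mulrA divfK ?gt_eqF ?exprn_gt0// expr2 mulrA.
    rewrite ler_wpM2r//.
    have Kk : K i.+1 <= k0.
      by rewrite /k0 (bigD1 (Ordinal ir))//= lerDl sumr_ge0.
    have g1 : 1 <= g i.+1.
      have : 1 <= i.+1%:R :> R by rewrite ler1n.
      have : i.+2%:R <= r%:R :> R by rewrite ler_nat.
      rewrite /g -!natr1; move: (i%:R) (r%:R) => x y h1 h2; nra.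
    have := C1; have := ler_wpM2l k00 g1; lra.
  have := @moment_barrier_step (k0 * q ^+ n) _ r0 IH hr i u ir.
  have -> : k0 * q ^+ n.+1 = k0 * q ^+ n * q by rewrite exprSr mulrA.
  by apply; rewrite mulr_ge0 ?exprn_ge0.
apply/ler_addgt0Pr => e e0.
have [n hn] := exp_vanish (k0 * g j * rin (f (D ^+ j) v) v) q0 q1 e0.
have := iter n j v jr; move: hn; rewrite mulrDl; lra.
Qed.
End OneMoment.
End Moments.

(** * Moments along a sequence of maps *)

Section AsymptoticMoments.
Context {R : realType} {A : cstarAlgType R} {H : hilbertType R}.
Hypothesis A_comm : commutative (fun x y : A => x * y).
#[local] HB.instance Definition _ :=
  GRing.PzRing_hasCommutativeMul.Build (CstarAlgebra.sort A) A_comm.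
Variables (f : A -> bop H) (Psi : nat -> A -> bop H) (t : A).
Hypotheses (fP : representation f) (PsiP : forall n, cp_map (Psi n)).

Let fcp : cp_map f := representation_cp fP.
Let b : A := star t * t.

Lemma exprD_lipschitz (beta : R) j : 0 <= beta -> exists2 K, 0 <= K &
  forall u d, 0 <= u -> u <= beta -> 0 <= d -> d <= 1 ->
    (u + d) ^+ j <= u ^+ j + d * K.
Proof.
move=> beta0; elim: j => [|j [K K0 hK]].
  by exists 0 => // u d *; rewrite !expr0 mulr0 addr0.
exists (beta ^+ j + K * (beta + 1)).
  by rewrite addr_ge0 ?exprn_ge0// mulr_ge0// addr_ge0.
move=> u d u0 ub d0 d1; have ud0 : 0 <= u + d by rewrite addr_ge0.
rewrite exprSr; apply: le_trans (ler_wpM2r ud0 (hK u d u0 ub d0 d1)) _.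
have uj : u ^+ j <= beta ^+ j by apply: lerXn2r; rewrite ?nnegrE.
have h1 : d * u ^+ j <= d * beta ^+ j by rewrite ler_wpM2l.
have h2 : d * K * (u + d) <= d * K * (beta + 1).
  by rewrite ler_wpM2l ?mulr_ge0// lerD.
rewrite exprSr; lra.
Qed.

Lemma sqmod_shift_approx j (e : R) : 0 < e -> exists2 d : R, 0 < d & forall v,
  rin (f ((b + d%:C *: (1 : A)) ^+ j) v) v <=
  rin (f (b ^+ j) v) v + e * nrm v ^+ 2.
Proof.
move=> e0; have [K K0 hK] := exprD_lipschitz j (exprn_ge0 2 (nrm_ge0 t)).
have K1 : 0 < K + 1 by rewrite ltr_wpDl.
pose d := Num.min 1 (e / (K + 1)).
have d0 : 0 < d by rewrite lt_min ltr01 divr_gt0.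
have d1 : d <= 1 by rewrite ge_min lexx.
have dK : d * K <= e.
  have : d * (K + 1) <= e by rewrite -ler_pdivlMr// ge_min lexx orbT.
  lra.
exists d => // v.
have -> : rin (f (b ^+ j) v) v + e * nrm v ^+ 2 = rin (f (b ^+ j + e%:C *: (1 :
  A)) v) v.
  by rewrite (cpD fcp) (cpZ fcp) (cp1E fcp) rinDl rinZl rin_sqr.
apply: cp_mono => //; first exact: sqmod_shift_sa.
  rewrite starD sqmod_sa starZ star1.
  by have -> : (e%:C)^* = e%:C by exact: conjc_real.
move=> chi chiP; rewrite char_sqmod_shift// (charD chiP) char_scalar//
  char_sqmod//=.
apply: le_trans (hK _ d (sqr_ge0 _) _ (ltW d0) d1) _; last by rewrite lerD2l.
by apply: lerXn2r; rewrite ?nnegrE ?nrm_ge0// char_le.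
Qed.

Lemma moment_upper r j : asym_fixed f Psi (b ^+ r) -> (j <= r)%N ->
  small_form (fun n v => rin (Psi n (b ^+ j) v) v - rin (f (b ^+ j) v) v).
Proof.
move=> hr jr e e0; have e20 : 0 < e / 2 by rewrite divr_gt0.
have [d d0 hd] := sqmod_shift_approx j e20.
pose K := nrm (b ^+ j) + e / 2.
have K0 : 0 < K by rewrite ltr_wpDl ?nrm_ge0.
(* As the r-th power of b + d dominates d^r, an additive error h d^r in the r-th moment becomes a
   factor 1 + h; this h makes h (||b^j|| + e / 2) equal to e / 2. *)
pose h := e / 2 / K.
have h0 : 0 < h by rewrite divr_gt0.
have hd0 : 0 < h * d ^+ r by rewrite mulr_gt0// exprn_gt0.
apply: filterS (hr _ hd0) => n hn v.
have le_r u : rin (Psi n (b ^+ r) u) u <=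
    (1 + h) * rin (f ((b + d%:C *: (1 : A)) ^+ r) u) u.
  rewrite mulrDl mul1r.
  have h1 : h * (d ^+ r * nrm u ^+ 2) <= h * rin (f ((b + d%:C *: (1 : A)) ^+
    r) u) u.
    by rewrite ler_wpM2l ?(ltW h0)// sqmod_shift_lower.
  have h2 : rin (f (b ^+ r) u) u <= rin (f ((b + d%:C *: (1 : A)) ^+ r) u) u.
    apply: cp_mono => //; [exact: sqmod_sa|exact: sqmod_shift_sa|].
    move=> chi chiP; rewrite char_sqmod// char_sqmod_shift//=.
    by apply: lerXn2r; rewrite ?nnegrE ?addr_ge0 ?sqr_ge0 ?lerDl ?(ltW d0).
  have h3 : rin (Psi n (b ^+ r) u) u - rin (f (b ^+ r) u) u <= h * d ^+ r * nrm
    u ^+ 2.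
    rewrite -rinBl (le_trans (ler_norm _))// (le_trans (rin_le _ _))//.
    by rewrite expr2 mulrA ler_wpM2r ?nrm_ge0.
  lra.
have h1' : 1 <= 1 + h by rewrite lerDl ltW.
have := moment_le A_comm fP (PsiP n) d0 h1' le_r v jr.
have := ler_wpM2l (le_trans ler01 h1') (hd v).
have fb : rin (f (b ^+ j) v) v <= nrm (b ^+ j) * nrm v ^+ 2.
  rewrite (le_trans (ler_norm _))// (le_trans (rin_le _ _))//.
  by rewrite expr2 mulrA ler_wpM2r ?nrm_ge0// cp_norm.
have hK : h * K = e / 2 by rewrite /h divfK ?gt_eqF.
have := ler_wpM2l (ltW h0) fb.
have : h * K * nrm v ^+ 2 = e / 2 * nrm v ^+ 2 by rewrite hK.
rewrite /K; lra.
Qed.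

Definition moment_gap i n : bop H := f (b ^+ i) - Psi n (b ^+ i).

Lemma gapE i n v : moment_gap i n v = f (b ^+ i) v - Psi n (b ^+ i) v.
Proof. by []. Qed.

Lemma gap_sym i n : symmetric_op (moment_gap i n).
Proof.
move=> v w; rewrite !gapE rinBl rinBr.
by rewrite (sqmod_sym t fcp) (sqmod_sym t (PsiP n)).
Qed.

Lemma gap_bounded i : bounded_by (2 * nrm (b ^+ i)) (fun n v => moment_gap i n
  v).
Proof.
move=> n v; have h1 := cp_norm A_comm fcp (b ^+ i) v.
have h2 := cp_norm A_comm (PsiP n) (b ^+ i) v.
by have := ler_nrmB (f (b ^+ i) v) (Psi n (b ^+ i) v); rewrite -gapE; lra.
Qed.

Lemma gap_lower i :
  small_form (fun n v => rin (Psi n (b ^+ i) v) v - rin (f (b ^+ i) v) v) ->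
  small_form (fun n v => - rin (moment_gap i n v) v).
Proof. by apply: small_le => n v; rewrite gapE rinBl opprB. Qed.

Lemma asym_fixed_gap i : null_seq (fun n v => moment_gap i n v) ->
  asym_fixed f Psi (b ^+ i).
Proof.
apply: (null_le (c := 1)) => n v; by rewrite mul1r gapE nrm_distC.
Qed.

Let id_bounded : bounded_by 1 (fun (_ : nat) (v : H) => v).
Proof. by move=> n v; rewrite mul1r. Qed.

(* Smallness spreads from the range of [f x] to that of [b ^+ i], then
   everywhere because the gap [E] satisfies [0 <= E ^+ 3 <= E * b ^+ i * E]. *)
Lemma asym_fixed_of_gap i (x : A) N : star x * x = b ^+ N -> (N <= 4 * i)%N ->
  small_form (fun n v => rin (Psi n (b ^+ i) v) v - rin (f (b ^+ i) v) v) ->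
  small_form (fun n v => rin (moment_gap i n (f x v)) (f x v)) ->
  asym_fixed f Psi (b ^+ i).
Proof.
move=> xx N4 upp gx; have low := gap_lower upp.
have M0 : 0 <= 2 * nrm (b ^+ i) by rewrite mulr_ge0 ?nrm_ge0.
have Mb := gap_bounded i.
have Ex : null_seq (fun n v => moment_gap i n (f x v)).
  apply: (null_of_form (g := fun _ v => f x v) M0 (gap_sym i) Mb _ low gx).
  exact: rep_bounded.
(* Composing with the image of [star x * b ^+ (4 * i - N)] turns [x] into the fourth power of
   [b ^+ i], ready for two halvings. *)
have E4 : null_seq (fun n v => moment_gap i n (f (b ^+ (4 * i)) v)).
  apply: null_ext (null_comp (rep_bounded A_comm fP (star x * b ^+ (4 * i -
    N))) Ex).
  move=> n v; rewrite -repM// mulrA [x * _]mulrC xx -exprD subnKC//.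
have E2 : null_seq (fun n v => moment_gap i n (f (b ^+ (2 * i)) v)).
  apply: (null_halve M0 (gap_sym i) Mb (sqmod_sym t fcp _)).
  by apply: null_ext E4 => n v; rewrite -repM// -exprD -mulnDl.
have E1 : null_seq (fun n v => moment_gap i n (f (b ^+ i) v)).
  apply: (null_halve M0 (gap_sym i) Mb (sqmod_sym t fcp _)).
  by apply: null_ext E2 => n v; rewrite -repM// -exprD addnn -mul2n.
apply: asym_fixed_gap; apply: small_sqr_null.
apply: (@small_le _ _ _ (fun n v => rin (moment_gap i n (moment_gap i n v)) v)).
  by move=> n v; rewrite gap_sym rin_sqr.
apply: (null_small id_bounded); apply: (null_of_form M0 (gap_sym i) Mb Mb low).
apply: (@small_le _ _ _ (fun n v => rin (f (b ^+ i) (moment_gap i n v))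
  (moment_gap i n v))).
  move=> n v; rewrite [in X in X <= _]gapE rinBl gerBl.
  exact: sqmod_moment_ge0.
apply: (null_small Mb); apply: null_adj E1 => n v w.
by rewrite (sqmod_sym t fcp) gap_sym.
Qed.

Lemma moments_fixed i : 
  small_form (fun n v => rin (Psi n (b ^+ i) v) v - rin (f (b ^+ i) v) v) ->
  small_form (fun n v => rin (Psi n (b ^+ i.+2) v) v - rin (f (b ^+ i.+2) v) v)
    ->
  asym_fixed f Psi (b ^+ i.+1) ->
  forall m, (i < m)%N -> asym_fixed f Psi (b ^+ m).
Proof.
move=> low upp mid; have bsa : star b = b by exact: sqmod1_sa.
(* With F_j for the j-th moment, the form is F_(i+2) - 2 F_(i+1) b + b F_i b: upper bounds serve for
   the outer terms, and equality is needed only for the subtracted one. *)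
have key : forall z, null_seq (fun n v => Psi n (z * (t ^+ i * b)) v - Psi n (z
  * t ^+ i) (f b v)).
  apply: asym_mult_form => //; rewrite bsa -(sqmodX A_comm t i) -/b [b ^+ i *
    (b * b)]mulrA -!exprSr.
  apply: (@small_le _ _ _ (fun n v =>
    (rin (Psi n (b ^+ i.+2) v) v - rin (f (b ^+ i.+2) v) v) +
    ((rin (Psi n (b ^+ i) (f b v)) (f b v) - rin (f (b ^+ i) (f b v)) (f b v)) +
     rin (Psi n (b ^+ i.+1) v - f (b ^+ i.+1) v) ((- 2)%:C *: f b v)))).
    move=> n v; rewrite rinZr !rinBl.
    have -> : rin (f (b ^+ i.+2) v) v = rin (f (b ^+ i.+1) v) (f b v).
      by rewrite exprS repM// (cp_radj fcp) bsa.
    have -> : rin (f (b ^+ i) (f b v)) (f b v) = rin (f (b ^+ i.+1) v) (f b v).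
      by rewrite -repM// -exprSr.
    lra.
  apply: smallD => //; apply: smallD.
    exact: (small_comp (rep_bounded A_comm fP b) low).
  apply: (@null_small _ _ (2 * nrm b)) mid => n v.
  by rewrite nrmZ nrmC normrN ger0_norm// -mulrA ler_wpM2l// rep_bounded.
elim=> [//|m IH]; rewrite ltnS leq_eqVlt => /predU1P[<-//|im].
have {}IH := IH im.
(* For [z = b ^+ (m - i) * star (t ^+ i)] the relation [key] compares the moment m + 1 with the
   moment m times [f b]. *)
have e2 : b ^+ (m - i) * star (t ^+ i) * t ^+ i = b ^+ m.
  by rewrite -mulrA -(sqmodX A_comm t i) -/b -exprD subnK// ltnW.
have e1 : b ^+ (m - i) * star (t ^+ i) * (t ^+ i * b) = b ^+ m.+1.
  by rewrite mulrA e2 -exprSr.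
apply: (@null_ext _ _ _ (fun n v =>
  (Psi n (b ^+ (m - i) * star (t ^+ i) * (t ^+ i * b)) v -
     Psi n (b ^+ (m - i) * star (t ^+ i) * t ^+ i) (f b v)) +
  (Psi n (b ^+ m) (f b v) - f (b ^+ m) (f b v)))).
  by move=> n v; rewrite e1 e2 addrA subrK -repM// -exprSr.
apply: nullD; first exact: key.
exact: (null_comp (rep_bounded A_comm fP b) IH).
Qed.

Lemma bimonomial_sqr p q (x : A) : x = star t ^+ p * t ^+ q ->
  star x * x = b ^+ (p + q).
Proof.
move=> ->; rewrite starMA !starX starK exprD !exprMn; ring.
Qed.

(** [star k1], of degree i, takes as many of the p factors [star t] as it can hold and is completed
    by factors [t]; [k2] takes the rest. *)
Lemma bimonomial_split p q i : (i <= (p + q)./2)%N -> exists k1 k2 : A,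
  [/\ star k1 * k1 = b ^+ i, star k2 * k2 = b ^+ (p + q - i) &
      star k1 * k2 = star t ^+ p * t ^+ q].
Proof.
move=> ipq; have i2 : (i.*2 <= p + q)%N.
  by rewrite (leq_trans (_ : _ <= (p + q)./2.*2)%N) ?leq_double//
    -{2}[(p + q)%N]odd_double_half leq_addl.
pose m := minn p i.
have mp : (m <= p)%N by exact: geq_minl.
have mi : (m <= i)%N by exact: geq_minr.
have imq : (i - m <= q)%N by rewrite /m; move: i2; rewrite -addnn /minn;
  case: ifP; lia.
exists (star t ^+ (i - m) * t ^+ m), (star t ^+ (p - m) * t ^+ (q - (i - m))).
split.
- by rewrite (bimonomial_sqr erefl) subnK.
- by rewrite (bimonomial_sqr erefl); congr (_ ^+ _); lia.
- rewrite starMA !starX starK.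
  rewrite -{2}(subnK mp) -{2}(subnK imq) !exprD; ring.
Qed.

Theorem sqmod_mult_domain p q r : p <> q -> (p + q < 2 * r)%N ->
  asym_fixed f Psi (star t ^+ p * t ^+ q) -> asym_fixed f Psi (b ^+ r) ->
  mult_domain f Psi (b ^+ r).
Proof.
move=> pq pqr hx hr; set x := _ * _ in hx.
have xx : star x * x = b ^+ (p + q) by exact: bimonomial_sqr.
have upp j : (j <= r)%N -> _ := moment_upper hr.
have MP := mult_domain_subalgebra A_comm fP PsiP.
have M1 : mult_domain f Psi 1 by exact: mult_domain1.
have [N1|N2] := leqP (p + q) 1.
  have N1' : (p + q)%N = 1%N by lia.
  have r1 : (1 <= r)%N by lia.
  suff Mx : mult_domain f Psi x.
    apply: subalgX => //; rewrite -[b]expr1 -N1' -xx.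
    by apply: subalgM => //; exact: subalg_star.
  apply: mult_domain_of_weak => //; rewrite xx N1'.
  apply: asym_fixed_gap.
  apply: (null_of_form (c := 1) (g := fun _ v => v) _ (gap_sym 1) (gap_bounded
    1)) => //.
  - by rewrite mulr_ge0 ?nrm_ge0.
  - by apply: gap_lower; exact: upp.
  apply: (@small_le _ _ _ (fun n v => rin (Psi n x v - f x v) (- (Psi n x v + f
    x v)))).
    move=> n v; have := cp_schwarz (PsiP n) x v; rewrite xx N1'.
    rewrite gapE rinNr rinBl rinBl !rinDr !rin_sqr (rinC (f x v)).
    have -> : rin (f (b ^+ 1) v) v = nrm (f x v) ^+ 2.
      have -> : b ^+ 1 = star x * x by rewrite xx N1'.
      by rewrite repM// (cp_radj fcp) starK rin_sqr.
    lra.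
  apply: (@null_small _ _ (2 * nrm x)) hx => n v; rewrite nrmN.
  have := ler_nrmD (Psi n x v) (f x v); have := cp_norm A_comm (PsiP n) x v.
  have := cp_norm A_comm fcp x v; lra.
(* The middle exponent is [i.+1], so that [i] and [i.+2] are its neighbours, both at most [r]. *)
pose i := ((p + q)./2).-1.
have iE : i.+1 = (p + q)./2 by rewrite /i; lia.
have ir : (i.+2 <= r)%N by rewrite iE; lia.
suff h2r : asym_fixed f Psi (b ^+ (r + r)).
  by apply: mult_domain_of_weak => //; rewrite sqmod_sa -exprD.
apply: (@moments_fixed i); [apply: upp; lia|exact: upp| |lia].
apply: (asym_fixed_of_gap xx); [lia|apply: upp; lia|].
have i2 : (i.+1 <= (p + q)./2)%N by rewrite iE.
have [k1 [k2 [k11 k22 k12]]] := bimonomial_split i2.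
have ipq : (i.+1 <= p + q)%N by lia.
have fpair y z u v : rin (f y u) (f z v) = rin (f (star z * y) u) v.
  by rewrite repM// (cp_radj fcp (star z)) starK.
have lr : (p + q - i.+1 <= r)%N by rewrite iE; lia.
pose w v := f (b ^+ i.+1) v.
(* As [k1 * x = k2 * b ^+ i.+1], the formal vectors k1 (x) f x v and k2 (x) w v have the same image
   under [f]. For [f] itself the Gram inequality is therefore an equality, and nothing is lost. *)
apply: (@small_le _ _ _ (fun n v =>
  (rin (Psi n (b ^+ (p + q - i.+1)) (w v)) (w v) -
     rin (f (b ^+ (p + q - i.+1)) (w v)) (w v)) +
  rin (Psi n x (w v) - f x (w v)) ((- 2)%:C *: f x v))).
  move=> n v; have := cp_form3 (PsiP n) k1 k2 0 (f x v) (- w v) 0.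
  rewrite !(bopN, mulr0, cp0 (PsiP n)) !(rinNl, rinNr, rin0l, rin0r, mulr0,
    addr0).
  rewrite opprK k11 k22 k12 -/x gapE rinZr !rinBl /w.
  have -> : rin (f (b ^+ i.+1) (f x v)) (f x v) = rin (f (b ^+ (i.+1 + (p +
    q))) v) v.
    by rewrite -repM// fpair exprD -xx; congr (rin (f _ v) v); ring.
  have -> : rin (f (b ^+ (p + q - i.+1)) (f (b ^+ i.+1) v)) (f (b ^+ i.+1) v) =
      rin (f (b ^+ (i.+1 + (p + q))) v) v.
    by rewrite -repM// fpair sqmod_sa -!exprD subnK.
  have -> : rin (f x (f (b ^+ i.+1) v)) (f x v) = rin (f (b ^+ (i.+1 + (p +
    q))) v) v.
    by rewrite -repM// fpair exprD -xx; congr (rin (f _ v) v); ring.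
  lra.
apply: smallD.
  exact: (small_comp (rep_bounded A_comm fP (b ^+ i.+1)) (upp _ lr)).
have wb : bounded_by (nrm (b ^+ i.+1)) (fun (_ : nat) v => w v).
  exact: rep_bounded.
apply: (@null_small _ _ (2 * nrm x)) (null_comp wb hx) => n v.
by rewrite nrmZ nrmC normrN ger0_norm// -mulrA ler_wpM2l// rep_bounded.
Qed.
End AsymptoticMoments.

(** * From the multiplicative domain to hyperrigidity *)

Section Hyperrigidity.
Context {R : realType} {A : cstarAlgType R}.
Hypothesis A_comm : commutative (fun x y : A => x * y).

Lemma opnorm_null (H : hilbertType R) (f : A -> bop H) (Phi : nat -> bop H ->
  bop H)
    (y : A) :
  (opnorm (Phi k (f y) - f y) @[k --> \oo] --> (0 : R)) <->
  asym_fixed f (fun k => Phi k \o f) y.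
Proof.
have ge0 T : 0 <= opnorm (T : bop H).
  apply: le_trans (ub_le_sup _ _); first exact: (nrm_ge0 (T 0)).
    have [M M0 TM] := bop_bound T; exists M => _ [u /= u1 <-].
    apply: le_trans (TM u) _; rewrite ler_piMr//.
    by rewrite -lecR -nrmE.
  by exists 0 => //=; rewrite normr0.
split=> [/cvgrPdist_le lim e e0|null_seq].
  apply: filterS (lim e e0) => k; rewrite sub0r normrN ger0_norm// => le v.
  rewrite /= -bopBE; apply: le_trans (le_opnorm _ _) _.
  by rewrite ler_wpM2r ?nrm_ge0.
apply/cvgrPdist_le => e e0; apply: filterS (null_seq e e0) => k le.
rewrite sub0r normrN ger0_norm//; apply: opnorm_le => //; exact: ltW.
Qed.

Theorem hyperrigid_bimonomials (t : A) (Xi : set (nat * nat)) p q r :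
  let G := [set star t ^+ mn.1 * t ^+ mn.2 | mn in Xi] in
  Sigma (p, q, r) -> Xi (p, q) -> Xi (r, r) -> cstar_gen G = setT ->
  hyperrigid G.
Proof.
move=> G [/= pq pqr] Xpq Xrr G_gen; split;
  first by exists (star t ^+ p * t ^+ q), (p, q).
move=> H f [fP _] Phi PhiP hG a; apply/opnorm_null.
have PsiP k : cp_map (Phi k \o f) by exact: ucp_cp.
have {}hG mn : Xi mn -> asym_fixed f (fun k => Phi k \o f) (star t ^+ mn.1 * t
  ^+ mn.2).
  by move=> Xmn; apply/opnorm_null/hG; exists mn.
pose M := mult_domain f (fun k => Phi k \o f).
have MP : cstar_subalgebra M by exact: mult_domain_subalgebra.
have M1 : M 1 by exact: mult_domain1.
have Mr : M ((star t * t) ^+ r).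
  apply: (sqmod_mult_domain A_comm fP PsiP pq pqr); first exact: hG Xpq.
  by rewrite sqmodX// starX; exact: hG Xrr.
have r0 : (0 < r)%N by case: (r) pqr => //; rewrite muln0.
(* The r-th power is injective on nonnegative reals, so the value of b at a character is determined
   by that of b^r. *)
have Mb : M (star t * t).
  apply: stone_weierstrass => // chi chi' chiP chiP' /(_ _ Mr).
  rewrite -[star t * t]expr1 -!exprM mul1n !char_sqmod// => /complexI/eqP.
  by rewrite eqrXn2 ?sqr_ge0// !expr1 => /eqP ->.
have GM : G `<=` M.
  move=> _ [mn Xmn <-]; apply: mult_domain_of_weak => //; first exact: hG.
  rewrite (bimonomial_sqr A_comm erefl); apply: asym_mult_weak => //.
  by have [] := subalgX MP M1 (mn.1 + mn.2) Mb.
have [Ma _] : M a by apply: (cstar_gen_min MP M1 GM); rewrite G_gen.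
exact: asym_mult_weak.
Qed.
End Hyperrigidity.

Theorem theorem2p2 (R : realType) (A : cstarAlgType R)
    (A_comm : commutative (fun x y : A => x * y))
    (t : A) (t_gen : cstar_gen [set t] = setT)
    (Xi : set (nat * nat))
    (cond :
      (* (i) *)
      ((exists p q r : nat, [/\ Sigma (p, q, r), Xi (p, q) & Xi (r, r)]) /\
       is_gcd [set mn.1%:Z - mn.2%:Z | mn in Xi] 1)
      \/
      (* (ii) *)
      (exists p q r : nat,
        [/\ Sigma (p, q, r), Xi = [set (p, q); (r, r)] &
          let n := `|p%:Z - q%:Z|%N in
          exists (eps : R) (L : 'I_n -> set R[i]),
            [/\ 0 < eps,
                forall j, borel (L j),
                forall j, L j `<=` [set expi phi | phi in `[0, 2 * pi / n%:R[],
                trivIset setT L &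
                spectrum t `<=`
                  \bigcup_j [set z | exists eta omega,
                    [/\ eps <= eta, L j omega &
                        z = eta%:C * omega * expi (2 * pi * j%:R / n%:R)]]]])) :
  let G : set A := [set star t ^+ mn.1 * t ^+ mn.2 | mn in Xi] in
  cstar_gen G = setT /\ hyperrigid G.
Proof.
move=> G; suff [G_gen [p [q [r [pqr Xpq Xrr]]]]] : cstar_gen G = setT /\
    exists p q r, [/\ Sigma (p, q, r), Xi (p, q) & Xi (r, r)].
  by split=> //; exact: (hyperrigid_bimonomials A_comm pqr Xpq Xrr).
case: cond => [[[p [q [r [pqr Xpq Xrr]]]] gcd1]|].
  split; last by exists p, q, r.
  apply: cstar_gen_bimonomials => // chi chi' chiP chiP' e.
  have r0 : (0 < r + r)%N by case: (r) pqr.2 => //=; rewrite muln0.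
  have zz' := bimonomial_nrm_eq r0 (e _ Xrr).
  (* Phases are compared by a quotient, so the value 0 is settled by the modulus alone. *)
  have [z'0|z'0] := eqVneq (chi' t) 0.
    by rewrite z'0; apply: nrm_eq0; rewrite zz' z'0 nrm0.
  suff : chi t / chi' t = 1 by move/divr1_eq.
  apply: (expr_order_dvd gcd1) => _ [mn Xmn <-].
  exact: (bimonomial_phase z'0 zz' (e _ Xmn)).
move=> [p [q [r [pqr XiE [eps [L [eps0 _ Larc Ldisj spec]]]]]]].
have Xpq : Xi (p, q) by rewrite XiE; left.
have Xrr : Xi (r, r) by rewrite XiE; right.
split; last by exists p, q, r.
apply: cstar_gen_bimonomials => // chi chi' chiP chiP' /(_ _ Xpq)/= e.
(* Since p <> q, the pair (p, q) has positive degree and already determines the modulus. *)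
have pq0 : (0 < p + q)%N by have [/= pq _] := pqr; lia.
have zz' := bimonomial_nrm_eq pq0 e.
have [z'0|z'0] := eqVneq (chi' t) 0.
  by rewrite z'0; apply: nrm_eq0; rewrite zz' z'0 nrm0.
have [j _ [eta [w [eta1 Ljw zE]]]] := spec _ (char_spectrum (t := t) chiP).
have [k _ [eta' [w' [eta1' Lkw' zE']]]] := spec _ (char_spectrum (t := t) chiP').
have phase := bimonomial_phase z'0 zz' e.
rewrite zE zE' in zz' phase *.
exact: (sector_phase_inj Larc Ldisj (lt_le_trans eps0 eta1) (lt_le_trans eps0 eta1')
  Ljw Lkw' zz' phase).
Qed.
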